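(* Let $h\colon\mathbb{N}\to[1,\infty)$ with $h(n)\to\infty$ and let $M_n^{(p_k,z_k)_k}$ be the randomized algorithm defined in the context, with $N=2\lceil h(n)\log_2 n\rceil+1$. Let $\alpha>1/2$, let $\gamma=(\gamma_u)_u$ be weights with $0<\gamma_u\le1$, $d\in\mathbb{N}$, $n\ge2$ and $\tau\in(1/2,1)$. Then, with probability at least $1-\frac12(4\tau(1-\tau))^{N/2}$ over the choice of $(p_k,z_k)_{k=1}^N$, $$e^{\rm det}_{d,\alpha,\gamma}(M_n^{(p_k,z_k)_k})\le\inf_{1/2\le\lambda<\alpha}\Big(\frac{4\sqrt2}{(1-\tau)n}V_d(\alpha/\lambda,\gamma^{1/\lambda})\Big)^{\lambda}.$$
   Context: $\{1:m\}:=\{1,\ldots,m\}$. Weights $\gamma=(\gamma_u)_u$ indexed by finite $u\subset\mathbb{N}$, $0<\gamma_u\le1$, $\gamma_\emptyset=1$. For $h\in\mathbb{Z}^d$, $\mathrm{supp}(h)=\{j:h_j\ne0\}$, $r_{d,\alpha,\gamma}(h)=\gamma_{\mathrm{supp}(h)}^{-1}\prod_{j\in\mathrm{supp}(h)}|h_j|^\alpha$. The weighted Korobov space $\mathcal{H}_{d,\alpha,\gamma}$ consists of $f\colon[0,1]^d\to\mathbb{C}$ with absolutely convergent Fourier series $f=\sum_h\hat f(h)e^{2\pi ih\cdot x}$ and finite norm $\|f\|_{d,\alpha,\gamma}^2=\sum_h r_{d,\alpha,\gamma}(h)^2|\hat f(h)|^2$. $I_d(f)=\int_{[0,1]^d}f$.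 Lattice rule $Q_p^z(f)=\frac1p\sum_{k=0}^{p-1}f(\{kz/p\})$ with $\{\cdot\}$ the componentwise fractional part. For a deterministic rule $A$, $e^{\rm det}_{d,\alpha,\gamma}(A)=\sup_{\|f\|_{d,\alpha,\gamma}\le1}|I_d(f)-A(f)|$. $V_d(\alpha/\lambda,\gamma^{1/\lambda})=\sum_{\emptyset\ne u\subseteq\{1:d\}}\gamma_u^{1/\lambda}(2\zeta(\alpha/\lambda))^{|u|}$ with $\zeta$ the Riemann zeta function. Algorithm: $\mathcal{P}_n$ is the set of primes in $[\lceil n/2\rceil+1,n]$. For $k=1,\ldots,N$ independently, choose $p_k$ uniformly from $\mathcal{P}_n$ and then $z_k$ uniformly from $\{1:p_k-1\}^d$; for fixed $(p_k,z_k)_k$ the deterministic rule is $M_n^{(p_k,z_k)_k}(f)=\mathrm{median}\{Q_{p_k}^{z_k}(f):1\le k\le N\}$, where the median of complex numbers is taken separately for real and imaginary parts. *)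

(* Defs.v *)
From mathcomp Require Import all_boot all_order all_algebra.
From mathcomp Require Import all_classical all_reals all_analysis.
From mathcomp Require Export complex.
Set Implicit Arguments. Unset Strict Implicit. Unset Printing Implicit Defensive.
Import Order.TTheory GRing.Theory Num.Theory numFieldNormedType.Exports.
Local Open Scope classical_set_scope.
Local Open Scope ring_scope.

Section Korobov.
Variable R : realType.

Definition cre (z : R[i]) : R := complex.Re z.
Definition cim (z : R[i]) : R := complex.Im z.
Definition cnorm (z : R[i]) : R := Num.sqrt (cre z ^+ 2 + cim z ^+ 2).
Definition expi (t : R) : R[i] := (cos t +i* sin t)%C.
Definition cR (r : R) : R[i] := (r +i* 0)%C.

Definition zeta (s : R) : R :=
  limn (fun m => \sum_(1 <= k < m) ((k%:R : R) `^ (- s))).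

Definition freq (d : nat) := {ffun 'I_d -> int}.

Definition dotx (d : nat) (h : freq d) (x : 'I_d -> R) : R :=
  \sum_(j < d) (h j)%:~R * x j.

Definition box_pt (d K : nat) (g : {ffun 'I_d -> 'I_(2 * K).+1}) : freq d :=
  [ffun j => (g j)%:Z - K%:Z].

Definition box_sum (d : nat) (c : freq d -> R[i]) (x : 'I_d -> R) (K : nat)
  : R[i] :=
  \sum_(g : {ffun 'I_d -> 'I_(2 * K).+1})
     c (box_pt g) * expi (2 * pi * dotx (box_pt g) x).

(* f(x) = sum_h c(h) e^{2 pi i h.x}, the (absolutely convergent) series
   summed over the exhausting boxes [-K,K]^d *)
Definition fourier_series (d : nat) (c : freq d -> R[i]) (x : 'I_d -> R)
  : R[i] :=
  (limn (fun K => cre (box_sum c x K)) +i* limn (fun K => cim (box_sum c x K)))%C.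

Definition abs_summable (d : nat) (c : freq d -> R[i]) : Prop :=
  (\esum_(h in [set: freq d]) (cnorm (c h))%:E < +oo)%E.

Definition supp (d : nat) (h : freq d) : {set 'I_d} := [set j | h j != 0].

Definition rweight (d : nat) (alpha : R) (gamma : {set 'I_d} -> R) (h : freq d)
  : R :=
  (gamma (supp h))^-1 * \prod_(j in supp h) ((`|h j|%:~R : R) `^ alpha).

Definition korobov_norm2 (d : nat) (alpha : R) (gamma : {set 'I_d} -> R)
  (c : freq d -> R[i]) : \bar R :=
  (\esum_(h in [set: freq d]) ((rweight alpha gamma h) ^+ 2 * cnorm (c h) ^+ 2)%:E)%E.

(* unit ball of H_{d,alpha,gamma}, each f being given by its Fourier
   coefficients c = fhat *)
Definition korobov_ball (d : nat) (alpha : R) (gamma : {set 'I_d} -> R)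
  : set (freq d -> R[i]) :=
  [set c | abs_summable c /\ (korobov_norm2 alpha gamma c <= 1)%E].

Definition integral_d (d : nat) (c : freq d -> R[i]) : R[i] := c [ffun => 0].

Definition edet (d : nat) (alpha : R) (gamma : {set 'I_d} -> R)
  (A : (('I_d -> R) -> R[i]) -> R[i]) : \bar R :=
  ereal_sup [set (cnorm (integral_d c - A (fourier_series c)))%:E
            | c in korobov_ball alpha gamma].

Definition frac (t : R) : R := t - (Num.floor t)%:~R.

Definition lattice_rule (d : nat) (p : nat) (z : 'I_d -> nat)
  (f : ('I_d -> R) -> R[i]) : R[i] :=
  cR (p%:R)^-1 * \sum_(k < p) f (fun j => frac ((k * z j)%:R / p%:R)).

Definition median (s : seq R) : R := nth 0 (sort <=%R s) (size s)./2.
Definition cmedian (s : seq R[i]) : R[i] :=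
  (median (map cre s) +i* median (map cim s))%C.

Definition median_rule (d N : nat) (pz : 'I_N -> nat * ('I_d -> nat))
  (f : ('I_d -> R) -> R[i]) : R[i] :=
  cmedian [seq lattice_rule (pz k).1 (pz k).2 f | k <- enum 'I_N].

(* P_n = primes in [ceil(n/2)+1, n];  ceil(n/2) = (n+1)./2 *)
Definition primes_set (n : nat) : {set 'I_n.+1} :=
  [set p : 'I_n.+1 | prime p && ((n.+1)./2 < p)%N].

Definition sample (n d : nat) := ('I_n.+1 * {ffun 'I_d -> 'I_n.+1})%type.

(* law of one pair (p,z): p uniform on P_n, then z uniform on {1..p-1}^d *)
Definition pz_weight (n d : nat) (x : sample n d) : R :=
  if (x.1 \in primes_set n) && [forall j, (0 < x.2 j)%N && (x.2 j < x.1)%N]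
  then (#|primes_set n|%:R * ((x.1).-1)%:R ^+ d)^-1 else 0.

Definition omega_space (n d N : nat) := {ffun 'I_N -> sample n d}.

Definition to_pz (n d N : nat) (w : omega_space n d N)
  : 'I_N -> nat * ('I_d -> nat) :=
  fun k => (nat_of_ord (w k).1, fun j => nat_of_ord ((w k).2 j)).

Definition prob (n d N : nat) (E : omega_space n d N -> Prop) : R :=
  \sum_(w : omega_space n d N | `[< E w >]) \prod_(k < N) pz_weight (w k).

Definition Nsamples (h : nat -> R) (n : nat) : nat :=
  (2 * absz (Num.ceil (h n * (ln (n%:R : R) / ln 2))))%N.+1.

Definition Vd (d : nat) (s : R) (g : {set 'I_d} -> R) : R :=
  \sum_(u : {set 'I_d} | u != finset.set0) g u * (2 * zeta s) ^+ #|u|.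

Definition err_bound (d : nat) (alpha : R) (gamma : {set 'I_d} -> R)
  (n : nat) (tau lambda : R) : R :=
  ((4 * Num.sqrt 2) / ((1 - tau) * n%:R)
     * Vd (alpha / lambda) (fun u => gamma u `^ lambda^-1)) `^ lambda.

End Korobov.

(* Main.v *)
(* For a prime p, the error of the lattice rule with generating vector z is the
   sum of the Fourier coefficients over the nonzero h with p | h.z.  By
   Cauchy-Schwarz it is at most T^lambda whenever the sum of r(h)^(-1/lambda)
   over those h is at most T, because l^1 norms dominate l^(2 lambda) norms for
   lambda >= 1/2.  A given h is hit with probability at most 1/(p-1), unless p
   divides h, and such h only carry a fraction p^(-alpha/lambda) <= 1/p of the
   total mass V; since p > n/2, the mean of the sum is at most 4V/n and by Markov
   each draw is bad with probability at most 1 - tau.  The median is good as soon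
   as a majority of the draws is good, and a bad majority has probability at
   most (4 tau (1 - tau))^(N/2) / 2.  Bertrand's postulate is needed for the set
   of admissible primes to be nonempty, so that the weights of the samples
   really form a probability distribution. *)
Require Import Defs.
From mathcomp Require Import all_boot all_order all_algebra.
From mathcomp Require Import all_classical all_reals all_analysis.
From mathcomp Require Import zify ring lra.
Set Implicit Arguments. Unset Strict Implicit. Unset Printing Implicit Defensive.

(** * Bertrand's postulate *)

Lemma bin_doubleS m : 'C(m.+1.*2, m.+1) = 2 * 'C(m.*2.+1, m).
Proof.
have := mul_bin_diag m.*2.+2 m; rewrite doubleS /= => e.
by apply/eqP; rewrite -(eqn_pmul2l (ltn0Sn m)) -e; apply/eqP; nia.
Qed.

Lemma bin_double_oddS m : m.*2.+1 * 'C(m.*2, m) = m.+1 * 'C(m.*2.+1, m).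
Proof. by have := mul_bin_down m.*2.+1 m; rewrite /= => ->; congr (_ * _); lia. Qed.

(** The two identities above combine to [m.+1 * 'C(m.+1.*2, m.+1) = 2 * m.*2.+1 * 'C(m.*2, m)], so
    the right-hand side grows by a factor of at least 4 per step. *)
Lemma central_bin_geq m : 0 < m -> 4 ^ m <= m.*2 * 'C(m.*2, m).
Proof.
elim: m => // -[|m] IH _; first by [].
have {IH} IH := IH isT.
have := bin_doubleS m.+1; have := bin_double_oddS m.+1.
rewrite expnS; move: IH; set x := 4 ^ _; set c := 'C(_, _); set e := 'C(_, _).
move=> *; nia.
Qed.

(** The ratio of consecutive terms is [2 * (2 * m + 3) / (m + 2)], which is below 4. *)
Lemma odd_bin_leq m : 'C(m.*2.+1, m) <= 4 ^ m.
Proof.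
elim: m => [|m IH] //.
have := bin_doubleS m; have := bin_double_oddS m.+1.
rewrite expnS; move: IH; set x := 4 ^ _; set c := 'C(_, _); set e := 'C(_, _).
set f := 'C(_, _) => *; nia.
Qed.

Lemma prod_prime_divisors_leq (s : seq nat) N :
    uniq s -> all prime s -> all (dvdn^~ N) s -> 0 < N ->
  \prod_(p <- s) p <= N.
Proof.
move=> us ps ds N0; apply: dvdn_leq => //.
elim: s us ps ds => [|p s IH] /=; first by rewrite big_nil dvd1n.
move=> /andP[pNs us] /andP[pp ps] /andP[dp ds]; rewrite big_cons.
rewrite Gauss_dvd ?dp ?IH // prime_coprime // Euclid_dvd_prod //.
rewrite big_has; apply/hasPn => q qs; rewrite dvdn_prime2 ?(allP ps q) //.
by apply: contraNneq pNs => ->.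
Qed.

Lemma prime_dvd_fact p n : prime p -> (p %| n`!) = (p <= n).
Proof.
move=> pp; apply/idP/idP => [|pn]; last by rewrite dvdn_fact ?prime_gt0.
rewrite fact_prod Euclid_dvd_prod // big_has => /hasP[q].
by rewrite mem_index_iota => /andP[q0 qn] /dvdn_leq; lia.
Qed.

(** Erdős's induction. An even [n.+3] is not prime; for [n.+3 = 2k + 3] the primes up to [k + 2]
    fall under the induction hypothesis, and those from [k + 3] on all divide ['C(2k + 3, k + 1)],
    which is at most [4 ^ (k + 1)]. *)
Lemma primorial_leq n : \prod_(1 <= p < n.+1 | prime p) p <= 4 ^ n.
Proof.
elim/ltn_ind: n => -[|[|[|n]]] IH.
- by rewrite big_geq.
- by rewrite unlock.
- by rewrite unlock.
have [on|/negbTE en] := boolP (odd n.+3); last first.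
  rewrite big_mkcond big_nat_recr //= -big_mkcond /= ifN ?muln1.
    by apply: leq_trans (IH _ _) _ => //; rewrite leq_exp2l.
  by apply/negP => /even_prime[|]; rewrite ?en // => -[].
have [k Dk] : {k | n.+3 = k.+1.*2.+1} by exists n.+1./2; lia.
rewrite Dk (@big_cat_nat _ _ _ k.+3) //=; last lia.
have -> : 4 ^ k.+1.*2.+1 = 4 ^ k.+2 * 4 ^ k.+1.
  by rewrite -expnD; congr (_ ^ _); lia.
apply: leq_mul; first by apply: IH; lia.
apply: leq_trans (odd_bin_leq k.+1).
rewrite -big_filter; apply: prod_prime_divisors_leq.
- by rewrite filter_uniq ?iota_uniq.
- exact: filter_all.
- apply/allP => p; rewrite mem_filter mem_index_iota => /and3P[pp lp up].
  have /(_ _)/esym H := @bin_fact k.+1.*2.+1 k.+1 _.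
  have : p %| k.+1.*2.+1`! by apply: dvdn_fact; lia.
  rewrite H; last lia.
  rewrite Euclid_dvdM // => /orP[//|]; rewrite Euclid_dvdM // !prime_dvd_fact //.
  by move=> /orP[]; lia.
- by rewrite bin_gt0; lia.
Qed.

(** Legendre's formula, applied to [m.*2] factorial and twice to [m] factorial. *)
Lemma logn_central_bin p m : prime p ->
  logn p 'C(m.*2, m) =
  \sum_(1 <= k < m.*2.+1) (m.*2 %/ p ^ k - (m %/ p ^ k).*2).
Proof.
move=> pp; have := @bin_fact m.*2 m; rewrite -{3}addnn addnK => /(_ _) H.
have {H} := congr1 (logn p) (H _).
have -> : m <= m.*2 by lia.
move=> /(_ isT).
rewrite !lognM ?muln_gt0 ?fact_gt0 ?bin_gt0 //; try lia.
rewrite !logn_fact //.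
(* The range is extended to that of the other sum; the added terms vanish because [m < p ^ k] for
   [k > m]. *)
have -> : \sum_(1 <= k < m.+1) m %/ p ^ k = \sum_(1 <= k < m.*2.+1) m %/ p ^ k.
  rewrite [RHS](@big_cat_nat _ _ _ m.+1) //=; last lia.
  rewrite [X in _ + X]big_nat_cond [X in _ + X]big1 ?addn0 // => k.
  rewrite andbT => /andP[mk _]; apply: divn_small.
  by apply: leq_trans mk _; apply/ltnW/ltn_expl/prime_gt1.
move=> E; apply/(@addnI (\sum_(1 <= k < m.*2.+1) (m %/ p ^ k).*2)).
rewrite -big_split /= addnC.
under [X in _ = X]eq_bigr => k _.
  rewrite subnKC; last by rewrite -!muln2 -leq_divRL; nia.
  over.
rewrite -E; congr (_ + _); under eq_bigr do rewrite -muln2.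
by rewrite -big_distrl /= muln2 addnn.
Qed.

(** Each term of Legendre's sum is 0 or 1, and it is 0 once [p ^ k] exceeds [m.*2]. *)
Lemma logn_central_bin_leq p m : prime p -> 0 < m ->
  logn p 'C(m.*2, m) <= trunc_log p m.*2.
Proof.
move=> pp m0; rewrite logn_central_bin //; set t := trunc_log _ _.
have p1 := prime_gt1 pp.
have tm : t <= m.*2.
  have : p ^ t <= m.*2 by apply: trunc_logP => //; lia.
  by apply: leq_trans; apply/ltnW/ltn_expl.
rewrite (@big_cat_nat _ _ _ t.+1) //= [X in _ + X]big_nat_cond.
rewrite [X in _ + X]big1 ?addn0 => [|k].
  apply: leq_trans (_ : \sum_(1 <= k < t.+1) 1 <= _); last first.
    by rewrite sum_nat_const_nat muln1 subn1.
  apply: leq_sum => k _; set q := p ^ k.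
  have q0 : 0 < q by rewrite expn_gt0 ltnW.
  by rewrite -ltnS ltn_subLR; [rewrite ltn_divLR //; have := ltn_ceil m q0; nia|
     rewrite -!muln2 leq_divRL //; have := leq_trunc_div m q; nia].
rewrite andbT => /andP[tk _]; rewrite divn_small //.
apply: leq_trans (trunc_log_ltn _ p1) _.
by rewrite leq_exp2l.
Qed.

Lemma pfactor_central_bin_leq p m : 0 < m -> p ^ logn p 'C(m.*2, m) <= m.*2.
Proof.
move=> m0; have [pp|/negbTE npp] := boolP (prime p); last first.
  by rewrite lognE npp expn0; lia.
apply: leq_trans (trunc_logP (prime_gt1 pp) (_ : 0 < m.*2)); last lia.
by rewrite leq_exp2l ?prime_gt1 // logn_central_bin_leq.
Qed.

(** Here [m.*2 %/ p = 2] and [m %/ p = 1], so the first term of Legendre's sum cancels; the later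
    ones vanish since [p ^ 2 >= 3 * p > m.*2]. *)
Lemma logn_central_bin_eq0 p m : prime p -> 2 < p <= m -> m.*2 < 3 * p ->
  logn p 'C(m.*2, m) = 0.
Proof.
move=> pp /andP[p2 pm] mp; rewrite logn_central_bin //.
rewrite big_nat_cond big1 // => -[|[|k]] // _.
  rewrite expn1.
  have -> : m.*2 %/ p = 2.
    by apply/eqP; rewrite eqn_leq -ltnS ltn_divLR ?leq_divRL; lia.
  by have -> : m %/ p = 1 by apply/eqP; rewrite eqn_leq -ltnS ltn_divLR ?leq_divRL; lia.
rewrite divn_small // !expnS mulnA; apply: leq_trans mp _.
by have := expn_gt0 p k; set x := p ^ k; nia.
Qed.

Lemma exists_sqrtn n : exists s, s ^ 2 <= n < s.+1 ^ 2.
Proof.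
have H : exists s, s ^ 2 <= n by exists 0.
have B s : s ^ 2 <= n -> s <= n by rewrite -mulnn; nia.
case: (ex_maxnP H B) => s sn max; exists s; rewrite sn /= ltnNge.
by apply/negP => /max; rewrite ltnn.
Qed.

(** At [x = 32] both sides equal [2 ^ 30]; from there on [x ^ 6] grows by a factor of at most
    [(11 / 10) ^ 2 < 2] per step. *)
Lemma exp6_leq_2exp x : 32 <= x -> x ^ 6 <= 2 ^ (x - 2).
Proof.
elim: x => // x IH; rewrite leq_eqVlt => /predU1P[<-|x32].
  exact: (eq_leq (esym (expnM 2 5 6))).
have {}IH := IH x32.
have -> : x.+1 - 2 = (x - 2).+1 by lia.
rewrite (expnS 2); apply: leq_trans (leq_mul (leqnn 2) IH).
have -> : x.+1 ^ 6 = (x.+1 ^ 3) ^ 2 by rewrite -expnM.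
have -> : x ^ 6 = (x ^ 3) ^ 2 by rewrite -expnM.
have H : 10 * x.+1 ^ 3 <= 11 * x ^ 3 by rewrite !expnS !expn0; nia.
rewrite -!mulnn; move: H; set a := x.+1 ^ 3; set b := x ^ 3; nia.
Qed.

(* If no prime lies in ]m, 2m], then no prime factor exceeds 2m/3, and those above sqrt(2m) occur only once. *)
Lemma central_bin_leq m s : s ^ 2 <= m.*2 < s.+1 ^ 2 -> 31 <= s ->
    (forall p, m < p <= m.*2 -> ~~ prime p) ->
  'C(m.*2, m) <= m.*2 ^ s * 4 ^ (m.*2 %/ 3).
Proof.
move=> /andP[sm ms] s31 npr; set t := m.*2 %/ 3; set C := 'C(_, _).
have C0 : 0 < C by rewrite bin_gt0; lia.
have st : s <= t by rewrite leq_divRL //; rewrite -mulnn in sm; nia.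
have t3 : m.*2 < 3 * t.+1 by rewrite mulnC ltn_ceil.
have t3' : 3 * t <= m.*2 by rewrite mulnC leq_trunc_div.
rewrite -[leqLHS](partnT C0) (widen_partn _ (leq_maxl C t)).
rewrite (@big_cat_nat _ _ _ t.+1) //=; last by rewrite ltnS leq_maxr.
rewrite [X in _ * X]big_nat_cond [X in _ * X]big1 ?muln1; last first.
  move=> p; rewrite andbT => /andP[tp _].
  have [pp|/negbTE npp] := boolP (prime p); last by rewrite lognE npp.
  have [pm|mp] := leqP p m; first by rewrite logn_central_bin_eq0 //; lia.
  have [p2m|mp2] := leqP p m.*2; first by have := npr p; rewrite mp p2m pp => /(_ isT).
  have m0 : 0 < m by lia.
  have := logn_central_bin_leq pp m0; have := trunc_log_gt0 p m.*2.
  have -> : p.-1 < m.*2 = false by lia.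
  rewrite andbF; case: trunc_log => // _.
  by rewrite leqn0 => /eqP ->.
rewrite (@big_cat_nat _ _ _ s.+1) //=.
apply: leq_mul.
  rewrite big_ltn // lognE mul1n.
  apply: leq_trans (_ : \prod_(1 <= p < s.+1) m.*2 <= _).
    by apply: leq_prod => p _; apply: pfactor_central_bin_leq; lia.
  by rewrite prod_nat_const_nat subn1.
apply: leq_trans (primorial_leq t).
rewrite [leqRHS](@big_cat_nat _ _ _ s.+1) //=.
rewrite -[leqLHS]mul1n; apply: leq_mul.
  by rewrite big_seq_cond prodn_cond_gt0 // => p /andP[_ /prime_gt0].
rewrite [leqRHS]big_mkcond [leqLHS]big_nat_cond [leqRHS]big_nat_cond.
apply: leq_prod => p; rewrite andbT => /andP[sp pt].
case: ifP => [pp|npp]; last by rewrite lognE npp.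
rewrite -[leqRHS]expn1 leq_exp2l ?prime_gt1 //.
have m0 : 0 < m by lia.
apply: leq_trans (logn_central_bin_leq pp m0) _.
rewrite -ltnS -(ltn_exp2l _ _ (prime_gt1 pp)).
apply: leq_ltn_trans (trunc_logP (prime_gt1 pp) _) _; first lia.
by apply: leq_trans ms _; rewrite leq_sqr.
Qed.

(** If no such prime existed, the two bounds on the central binomial would give [4 ^ m <= m.*2 ^ (3
    * s.+1) < s.+1 ^ (6 * s.+1) <= 2 ^ (s ^ 2) <= 4 ^ m], where [s] is the integer square root of
    [m.*2]. *)
Lemma bertrand_large m : 480 < m -> exists2 p, prime p & m < p <= m.*2.
Proof.
move=> m480; have [/hasP[p]|/hasPn npr] := boolP (has prime (index_iota m.+1 m.*2.+1)).
  by rewrite mem_index_iota; exists p.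
have {}npr p : m < p <= m.*2 -> ~~ prime p.
  by move=> mp; apply: npr; rewrite mem_index_iota.
exfalso.
have [s sm] := exists_sqrtn m.*2.
(* The threshold 480 comes from [31 ^ 2 = 961 <= 2 * 481]. *)
have s31 : 31 <= s.
  by case/andP: sm => _; rewrite -mulnn; nia.
have := central_bin_leq sm s31 npr.
have := @central_bin_geq m; set t := m.*2 %/ 3; set C := 'C(_, _).
have m0 : 0 < m by lia.
move=> /(_ m0) H1 H2.
have {H1 H2} H : 4 ^ m <= m.*2 ^ s.+1 * 4 ^ t.
  by apply: leq_trans H1 _; rewrite expnS -mulnA leq_mul2l H2 orbT.
have t3 : 3 * t <= m.*2 by rewrite mulnC leq_trunc_div.
have {}H : 4 ^ (3 * m) <= m.*2 ^ (3 * s.+1) * 4 ^ m.*2.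
  apply: leq_trans (_ : (m.*2 ^ s.+1 * 4 ^ t) ^ 3 <= _).
    by rewrite mulnC expnM leq_exp2r.
  rewrite expnMn -!expnM (mulnC _ 3); apply: leq_mul => //.
  by rewrite leq_exp2l // mulnC.
have {}H : 4 ^ m <= m.*2 ^ (3 * s.+1).
  rewrite -(leq_pmul2r (_ : 0 < 4 ^ m.*2)) ?expn_gt0 // -expnD.
  by have -> : m + m.*2 = 3 * m by lia.
case/andP: sm => sm ms.
have : m.*2 ^ (3 * s.+1) < (s.+1 ^ 2) ^ (3 * s.+1) by rewrite ltn_exp2r.
have : (s.+1 ^ 2) ^ (3 * s.+1) <= 2 ^ (s ^ 2).
  rewrite -expnM.
  have -> : 2 * (3 * s.+1) = 6 * s.+1 by lia.
  rewrite expnM; apply: leq_trans (_ : (2 ^ (s.+1 - 2)) ^ s.+1 <= _).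
    by rewrite leq_exp2r // exp6_leq_2exp.
  by rewrite -expnM leq_exp2l // -mulnn; nia.
have : 2 ^ (s ^ 2) <= 4 ^ m.
  by rewrite -[4]/(2 ^ 2) -expnM leq_exp2l // mul2n.
lia.
Qed.

(** Small [m] are covered by the chain 1, 2, 3, 5, 7, 13, 23, 43, 83, 163, 317, 631: every entry
    after the first is a prime at most twice its predecessor, so the first entry above [m] works. *)
Lemma bertrand m : 0 < m -> exists2 p, prime p & m < p <= m.*2.
Proof.
have [/bertrand_large //|m480 m0] := ltnP 480 m.
have H p q : prime q -> q <= p.*2 -> p <= m < q -> exists2 p, prime p & m < p <= m.*2.
  by move=> pq qp mpq; exists q => //; lia.
have [l|l] := ltnP m 2; first by apply: (H 1 2) => //; lia.
have [l'|{}l] := ltnP m 3; first by apply: (H 2 3) => //; lia.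
have [l'|{}l] := ltnP m 5; first by apply: (H 3 5) => //; lia.
have [l'|{}l] := ltnP m 7; first by apply: (H 5 7) => //; lia.
have [l'|{}l] := ltnP m 13; first by apply: (H 7 13) => //; lia.
have [l'|{}l] := ltnP m 23; first by apply: (H 13 23) => //; lia.
have [l'|{}l] := ltnP m 43; first by apply: (H 23 43) => //; lia.
have [l'|{}l] := ltnP m 83; first by apply: (H 43 83) => //; lia.
have [l'|{}l] := ltnP m 163; first by apply: (H 83 163) => //; lia.
have [l'|{}l] := ltnP m 317; first by apply: (H 163 317) => //; lia.
by apply: (H 317 631) => //; lia.
Qed.

Import Order.TTheory GRing.Theory Num.Theory numFieldNormedType.Exports.
Local Open Scope classical_set_scope.
Local Open Scope ring_scope.

(** * Tail of the majority vote *)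

(** Complementation exchanges large and small subsets of a set of odd size, so exactly half of all
    subsets are large. *)
Lemma card_large_subsets m :
  #|[set J : {set 'I_m.*2.+1} | (m < #|J|)%N]%SET| = (2 ^ m.*2)%N.
Proof.
set A := [set J | _]%SET.
have AC : [set ~: J | J in A]%SET = (~: A)%SET.
  apply/setP => J; rewrite -[J]finset.setCK (mem_imset _ _ (@finset.setC_inj _)).
  rewrite finset.setCK !inE; have := cardsC J; rewrite card_ord; lia.
have := cardsC A; rewrite -AC (card_imset _ (@finset.setC_inj _)).
by rewrite -[#|{set _}|]cardsT -powersetT card_powerset cardsT card_ord expnS addnn -mul2n => /eqP; rewrite eqn_pmul2l // => /eqP.
Qed.

(** Since [b <= 1 - b], replacing the surplus factors [b] by [1 - b] until the exponents are [m.+1]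
    and [m] only increases the term; the one unpaired [b] is at most the square root. *)
Lemma binomial_term_le (R : realType) (b : R) (m j : nat) :
    0 <= b -> b <= 1 / 2 -> (m < j)%N -> (j <= m.*2.+1)%N ->
  b ^+ j * (1 - b) ^+ (m.*2.+1 - j) <= (b * (1 - b)) ^+ m * Num.sqrt (b * (1 - b)).
Proof.
move=> b0 b2 mj jm.
have b1 : b <= 1 - b by lra.
have c0 : 0 <= 1 - b by lra.
have bs : b <= Num.sqrt (b * (1 - b)).
  by rewrite -{1}(ger0_norm b0) -sqrtr_sqr ler_wsqrtr // expr2 ler_wpM2l.
apply: le_trans (_ : (b * (1 - b)) ^+ m * b <= _); last first.
  by rewrite ler_wpM2l // exprn_ge0 // mulr_ge0.
have -> : j = (m + 1 + (j - m.+1))%N by lia.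
set i := (j - m.+1)%N.
have -> : (m.*2.+1 - (m + 1 + i) = m - i)%N by lia.
rewrite !exprD exprMn expr1.
have -> : b ^+ m * b * b ^+ i * (1 - b) ^+ (m - i) = b ^+ m * b * (b ^+ i * (1 - b) ^+ (m - i)) by ring.
rewrite [leRHS]mulrAC ler_wpM2l ?mulr_ge0 ?exprn_ge0 //.
have im : (i <= m)%N by rewrite /i; lia.
rewrite -{2}(subnKC im) exprD ler_wpM2r ?exprn_ge0 //.
by rewrite lerXn2r.
Qed.

(** Outcomes are grouped by the set [J] of bad draws. Each of the [4 ^ m] large sets contributes at
    most [t ^ (m + 1/2)] with [t = tau * (1 - tau)], and [4 ^ m * t ^ (m + 1/2)] is half of
    [(4 * t) ^ (m + 1/2)]. *)
Lemma majority_tail (R : realType) (T : finType) (f : T -> R) (bad : pred T)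
    (m : nat) (tau : R) :
    (forall x, 0 <= f x) -> \sum_x f x = 1 -> 1 / 2 < tau < 1 ->
    \sum_(x | bad x) f x <= 1 - tau ->
  \sum_(w : {ffun 'I_m.*2.+1 -> T} | (m < #|[set k | bad (w k)]%SET|)%N)
     \prod_k f (w k)
  <= 1 / 2 * (4 * tau * (1 - tau)) `^ (m.*2.+1%:R / 2).
Proof.
move=> f0 f1 /andP[tau2 tau1] btau; set b := \sum_(x | bad x) f x in btau *.
have b12 : b <= 1 / 2 by clearbody b; lra.
have b0 : 0 <= b by apply: sumr_ge0.
have fb : \sum_(x | ~~ bad x) f x = 1 - b.
  by have := f1; rewrite (bigID bad) /= -/b => <-; rewrite addrAC subrr add0r.
pose B (w : {ffun 'I_m.*2.+1 -> T}) := [set k | bad (w k)]%SET.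
rewrite (partition_big B (fun J => m < #|J|)%N) //=.
set t := tau * (1 - tau).
have t0 : 0 <= t by rewrite mulr_ge0; lra.
(* The map [x * (1 - x)] increases on [[0, 1/2]], and [b <= 1 - tau <= 1/2]. *)
have bt : b * (1 - b) <= t by rewrite /t; nra.
apply: le_trans (_ : \sum_(J : {set 'I_m.*2.+1} | (m < #|J|)%N) (t ^+ m * Num.sqrt t) <= _).
  apply: ler_sum => J mJ.
  have -> : \sum_(w | (m < #|B w|)%N && (B w == J)) \prod_k f (w k) =
    \sum_(w in family (fun k => [pred x | bad x == (k \in J)])) \prod_k f (w k).
    apply: eq_bigl => w; apply/andP/familyP => [[_ /eqP <-] k|wJ].
      by rewrite !inE.
    suff -> : B w = J by [].
    by apply/setP => k; rewrite inE; have := wJ k; rewrite inE => /eqP.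
  rewrite -(bigA_distr_big_dep (fun k : 'I_m.*2.+1 => [pred x | bad x == (k \in J)]) (fun=> f)) /=.
  rewrite (bigID (mem J)) /=.
  rewrite (eq_bigr (fun=> b)); last first.
    by move=> k kJ; apply: eq_bigl => x; rewrite kJ eqb_id.
  rewrite [X in _ * X](eq_bigr (fun=> 1 - b)); last first.
    by move=> k kJ; rewrite -fb; apply: eq_bigl => x; rewrite (negbTE kJ) eqbF_neg.
  have -> : \prod_(i | i \notin J) (1 - b) = (1 - b) ^+ (m.*2.+1 - #|J|).
    by rewrite prodr_const -[X in (X - _)%N](card_ord m.*2.+1) -(cardC J) addKn.
  rewrite prodr_const.
  have cJ : (#|J| <= m.*2.+1)%N by rewrite -[leqRHS](card_ord m.*2.+1) max_card.
  apply: le_trans (binomial_term_le b0 b12 mJ cJ) _.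
  rewrite ler_pM ?sqrtr_ge0 ?exprn_ge0 ?ler_wsqrtr //; first by rewrite mulr_ge0; lra.
  by rewrite lerXn2r // nnegrE mulr_ge0; lra.
rewrite sumr_const.
have -> : #|(fun J : {set 'I_m.*2.+1} => m < #|J|)%N| = (2 ^ m.*2)%N.
  by rewrite -card_large_subsets; apply: eq_card => J; rewrite inE.
have -> : 4 * tau * (1 - tau) = 4 * t by rewrite /t mulrA.
have -> : (4 * t) `^ (m.*2.+1%:R / 2) = (4 * t) ^+ m * (2 * Num.sqrt t).
  have -> : m.*2.+1%:R / 2 = m%:R + 2^-1 :> R.
    by rewrite -addn1 natrD -muln2 natrM; field.
  have t40 : 0 <= 4 * t by rewrite mulr_ge0.
  rewrite powRD; last by apply/implyP => /eqP; have := ler0n R m; lra.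
  rewrite powR_mulrn // powR12_sqrt // sqrtrM //.
  by have -> : 4 = 2 ^+ 2 :> R; [ring|rewrite sqrtr_sqr ger0_norm].
have E4 : 2 ^+ m.*2 = 4 ^+ m :> R by rewrite -mul2n exprM; congr (_ ^+ _); ring.
rewrite -[leLHS]mulr_natl natrX E4 (exprMn _ 4 t).
move: (4 ^+ m) (t ^+ m) (Num.sqrt t) => x y z; lra.
Qed.

Lemma markov_fin (R : realType) (T : finType) (f g : T -> R) (c q : R) :
    (forall x, 0 <= f x) -> (forall x, 0 <= g x) -> 0 < c ->
    \sum_x f x * g x <= q * c ->
  \sum_(x | c < g x) f x <= q.
Proof.
move=> f0 g0 c0 fg; rewrite -(ler_pM2r c0); apply: le_trans fg.
rewrite mulr_suml [leRHS](bigID (fun x => c < g x)) /=.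
rewrite -[leLHS]addr0 lerD //; last by apply: sumr_ge0 => x _; rewrite mulr_ge0.
by apply: ler_sum => x /ltW cg; rewrite ler_wpM2l.
Qed.

Lemma sum_prod_ffun_eq1 (R : realType) (T : finType) (f : T -> R) (N : nat) :
  \sum_x f x = 1 -> \sum_(w : {ffun 'I_N -> T}) \prod_k f (w k) = 1.
Proof.
move=> f1; rewrite -(bigA_distr_bigA (fun=> f)) /=.
by apply: big1 => k _; rewrite f1.
Qed.

(** * Characters and the dual lattice *)

Section Characters.
Variable R : realType.
Implicit Types (t : R) (z : R[i]).

Lemma creD z1 z2 : cre (z1 + z2) = cre z1 + cre z2.
Proof. by case: z1 z2 => ? ? []. Qed.

Lemma cimD z1 z2 : cim (z1 + z2) = cim z1 + cim z2.
Proof. by case: z1 z2 => ? ? []. Qed.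

Lemma cre_cRM t z : cre (cR t * z) = t * cre z.
Proof. by case: z => a b; rewrite /cre /= mul0r subr0. Qed.

Lemma cim_cRM t z : cim (cR t * z) = t * cim z.
Proof. by case: z => a b; rewrite /cim /= mul0r addr0. Qed.

Lemma expiD t u : expi (t + u) = expi t * expi u.
Proof. by rewrite /expi cosD sinD; congr (_ +i* _)%C; ring. Qed.

Lemma expi0 : expi 0 = 1 :> R[i].
Proof. by rewrite /expi cos0 sin0. Qed.

Lemma expi_mulrn t n : expi (t *+ n) = expi t ^+ n.
Proof. by elim: n => [|n IH]; rewrite ?expi0 // mulrS expiD IH exprS. Qed.

Lemma expi_nat2pi n : expi (2 * pi * n%:R) = 1 :> R[i].
Proof.
rewrite mulr_natr expi_mulrn mulr_natl /expi cos2pi sin2pi.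
by rewrite (_ : (1 +i* 0)%C = 1) ?expr1n.
Qed.

Lemma expi_int2pi (n : int) : expi (2 * pi * n%:~R) = 1 :> R[i].
Proof.
case: n => n; first exact: expi_nat2pi.
rewrite NegzE rmorphN mulrN; set t := 2 * pi * _.
have : expi (- t) * expi t = 1 by rewrite -expiD addNr expi0.
by rewrite expi_nat2pi mulr1.
Qed.

(** The real part decides: it equals [1 - 2 * sin (pi * t) ^ 2], and the sine is positive. The
    imaginary part would fail at [t = 1/2]. *)
Lemma expi_neq1 t : 0 < t < 1 -> expi (2 * pi * t) != 1 :> R[i].
Proof.
move=> /andP[t0 t1]; apply/eqP => -[+ _].
have pi0 := pi_gt0 R.
have s0 : 0 < sin (pi * t) by apply: sin_gt0_pi; nra.
have -> : 2 * pi * t = (pi * t) *+ 2 by rewrite mulr2n; ring.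
have := cos2Dsin2 (pi * t); rewrite cos_mulr2n mulr2n; nra.
Qed.

(** Orthogonality of characters: a geometric sum whose ratio is a [p]-th root of unity, equal to 1
    exactly when [p] divides [S]. *)
Lemma character_sum (p : nat) (S : int) : (0 < p)%N ->
  \sum_(k < p) expi (2 * pi * (S%:~R / p%:R)) ^+ k
  = ((p %| S)%Z%:R * p%:R : R[i]).
Proof.
move=> p0; set w := expi _.
have pR : p%:R != 0 :> R by rewrite pnatr_eq0 -lt0n.
have wp : w ^+ p = 1.
  rewrite -expi_mulrn -(expi_int2pi S); congr expi.
  by rewrite -[LHS]mulr_natr; field.
have [/dvdzP[q Dq]|pS] := boolP (p %| S)%Z.
  have -> : w = 1.
    rewrite /w Dq rmorphM /= -pmulrn mulfK //.
    exact: expi_int2pi.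
  by under eq_bigr do rewrite expr1n; rewrite sumr_const card_ord mul1r.
rewrite mul0r.
have w1 : w != 1.
  (* Reducing [S] modulo [p] brings the angle into the open interval where [expi_neq1] applies. *)
  have -> : w = expi (2 * pi * ((S %% p)%Z%:~R / p%:R)).
    rewrite /w.
    have -> : S%:~R / p%:R = (S %/ p)%Z%:~R + (S %% p)%Z%:~R / p%:R :> R.
      by rewrite {1}(divz_eq S p) rmorphD rmorphM /= -pmulrn; field.
    by rewrite mulrDr expiD expi_int2pi mul1r.
  apply: expi_neq1.
  have r0 : (0 < (S %% p)%Z) by rewrite lt0r modz_ge0 ?andbT ?(dvdz_mod0P _ _); lia.
  rewrite divr_gt0 ?ltr0z ?ltr0n //= ltr_pdivrMr ?ltr0n // mul1r.
  by rewrite -[ltRHS]/((p%:Z)%:~R) ltr_int ltz_pmod.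
apply/eqP; rewrite -(mulrI_eq0 _ (mulfI (_ : w - 1 != 0))) ?subr_eq0 //.
by rewrite -subrX1 wp subrr.
Qed.

(** The frequencies whose exponential the rule averages to 1; every other exponential is averaged to
    0. *)
Definition dual_lattice (d p : nat) (z : 'I_d -> nat) (h : freq d) : bool :=
  (p %| \sum_(j < d) h j * (z j)%:Z)%Z.

(** Taking fractional parts changes the phase by an integer multiple of [2 * pi], collected in
    [F]. *)
Lemma expi_dotx_lattice (d p k : nat) (z : 'I_d -> nat) (h : freq d) :
    (0 < p)%N ->
  expi (2 * pi * dotx h (fun j => Defs.frac ((k * z j)%:R / p%:R))) =
  expi (2 * pi * ((\sum_(j < d) h j * (z j)%:Z)%:~R / p%:R)) ^+ k :> R[i].
Proof.
move=> p0; set S := \sum_(j < d) _.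
rewrite -expi_mulrn.
pose x (j : 'I_d) : R := (k * z j)%:R / p%:R.
pose F := \sum_(j < d) h j * Num.floor (x j).
have -> : dotx h (fun j => Defs.frac (x j)) = S%:~R / p%:R *+ k - F%:~R :> R.
  rewrite /dotx /S /F /x !rmorph_sum /= mulr_suml -sumrMnl -sumrB.
  apply: eq_bigr => j _; rewrite /Defs.frac !rmorphM /= mulrBr; congr (_ - _).
  by rewrite -[RHS]mulr_natr -pmulrn; ring.
rewrite mulrBr expiD mulrnAr.
have : expi (- (2 * pi * F%:~R)) * expi (2 * pi * F%:~R) = 1 :> R[i].
  by rewrite -expiD addNr expi0.
by rewrite expi_int2pi mulr1 => ->; rewrite mulr1.
Qed.

Lemma lattice_rule_box_sum (d p K : nat) (z : 'I_d -> nat) (c : freq d -> R[i]) :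
    (0 < p)%N ->
  lattice_rule p z (fun x => box_sum c x K) =
  \sum_(g : {ffun 'I_d -> 'I_(2 * K).+1})
    c (box_pt g) * (dual_lattice p z (box_pt g))%:R.
Proof.
move=> p0; rewrite /lattice_rule /box_sum exchange_big /= mulr_sumr.
apply: eq_bigr => g _; rewrite -mulr_sumr mulrCA; congr (_ * _).
under eq_bigr do rewrite expi_dotx_lattice //.
rewrite character_sum // -/(dual_lattice p z _) mulrCA -[RHS]mulr1; congr (_ * _).
have -> : p%:R = cR p%:R :> R[i].
  elim: p {p0} => // p IH; rewrite -natr1 IH -[in RHS]natr1.
  by rewrite /cR; apply/eqP; rewrite eq_complex /= addr0 !eqxx.
have pR : p%:R != 0 :> R by rewrite pnatr_eq0 -lt0n.
rewrite /cR; transitivity ((p%:R^-1 * p%:R - 0 * 0) +i* (p%:R^-1 * 0 + 0 * p%:R) : R[i])%C => //.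
by rewrite mulVf // !(mulr0, mul0r, subr0, addr0).
Qed.

End Characters.

(** * Sums over boxes of frequencies *)

Lemma cauchy_schwarz_sum (R : realFieldType) (I : Type) (r : seq I) (P : pred I)
    (x y : I -> R) :
  (\sum_(i <- r | P i) x i * y i) ^+ 2 <=
  (\sum_(i <- r | P i) x i ^+ 2) * (\sum_(i <- r | P i) y i ^+ 2).
Proof.
elim: r => [|i r IH]; first by rewrite !big_nil expr0n mulr0.
rewrite !big_cons; case: (P i) => //; move: IH.
have : 0 <= \sum_(j <- r | P j) x j ^+ 2 by apply: sumr_ge0 => j _; rewrite sqr_ge0.
have : 0 <= \sum_(j <- r | P j) y j ^+ 2 by apply: sumr_ge0 => j _; rewrite sqr_ge0.
move: (\sum_(j <- r | P j) y j ^+ 2) (\sum_(j <- r | P j) x j ^+ 2) => B A.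
move: (\sum_(j <- r | P j) _) (x i) (y i) => C u v B0 A0 CAB.
(* The cross term is handled by comparing squares: [(C * u * v) ^ 2 <= A * B * (u * v) ^ 2],
   followed by the inequality of arithmetic and geometric means. *)
have H : 2 * (C * (u * v)) <= A * v ^+ 2 + B * u ^+ 2.
  have s0 : 0 <= A * v ^+ 2 + B * u ^+ 2 by rewrite addr_ge0 // mulr_ge0 ?sqr_ge0.
  apply: le_trans (ler_norm _) _; rewrite -(ger0_norm s0) -ler_sqr ?nnegrE //.
  rewrite !real_normK ?num_real //.
  have : (C * (u * v)) ^+ 2 <= A * B * (u * v) ^+ 2.
    by rewrite exprMn ler_wpM2r ?sqr_ge0.
  have := sqr_ge0 (A * v ^+ 2 - B * u ^+ 2).
  nra.
rewrite sqrrD; nra.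
Qed.

(** As a list, a box can be filtered by predicates on frequencies, which sums over the index
    functions [g] do not allow directly. *)
Definition box (d K : nat) : seq (freq d) :=
  [seq box_pt g | g <- enum {ffun 'I_d -> 'I_(2 * K).+1}].

Lemma big_box (R : Type) (idx : R) (op : Monoid.com_law idx) d K (P : pred (freq d)) F :
  \big[op/idx]_(g : {ffun 'I_d -> 'I_(2 * K).+1} | P (box_pt g)) F (box_pt g) =
  \big[op/idx]_(h <- box d K | P h) F h.
Proof. by rewrite /box big_map big_enum_cond. Qed.

Lemma box_pt_inj d K : injective (@box_pt d K).
Proof.
move=> f g /ffunP fg; apply/ffunP => j; have := fg j; rewrite !ffunE => E.
by apply/val_inj => /=; lia.
Qed.

Lemma box_uniq d K : uniq (box d K).
Proof. by rewrite map_inj_uniq ?enum_uniq //; exact: box_pt_inj. Qed.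

Lemma mem_box d K h : (h \in box d K) = [forall j, `|h j|%N <= K]%N.
Proof.
apply/mapP/forallP => [[g _ ->] j|hK].
  by rewrite ffunE; have := ltn_ord (g j); move: (nat_of_ord _) => x; lia.
exists [ffun j => inord `|h j + K%:Z|]; first by rewrite mem_enum.
by apply/ffunP => j; rewrite !ffunE inordK; have := hK j; lia.
Qed.

Lemma sum_box_mono (R : realType) d (F : freq d -> R) :
    (forall h, 0 <= F h) ->
  {homo (fun K => \sum_(h <- box d K) F h) : K K' / (K <= K')%N >-> K <= K'}.
Proof.
move=> F0 K K' KK'.
have KP : perm_eq [seq h <- box d K' | h \in box d K] (box d K).
  apply: uniq_perm; rewrite ?filter_uniq ?box_uniq // => h.
  rewrite mem_filter andb_idr // !mem_box => /forallP hK.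
  by apply/forallP => j; apply: leq_trans (hK j) KK'.
rewrite [leRHS](bigID (fun h => h \in box d K)) /= -[X in _ <= X + _]big_filter (perm_big _ KP) /=.
by rewrite lerDl sumr_ge0.
Qed.

Lemma sum_box_le_esum (R : realType) d (F : freq d -> R) K :
    (forall h, 0 <= F h) ->
  ((\sum_(h <- box d K) F h)%:E <= \esum_(h in [set: freq d]) (F h)%:E)%E.
Proof.
move=> F0; apply: esum_ge; exists [set` box d K].
  by split=> //; exact: finite_seq.
by rewrite -fsbig_seq ?box_uniq // sumEFin.
Qed.

Lemma cvg_sum_box (R : realType) d (F : freq d -> R) :
    (\esum_(h in [set: freq d]) `|F h|%:E < +oo)%E ->
  cvgn (fun K => \sum_(h <- box d K) F h).
Proof.
move=> Foo.
have bnd G : (forall h, 0 <= G h <= 2 * `|F h|) -> cvgn (fun K => \sum_(h <- box d K) G h).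
  move=> G0; apply: nondecreasing_is_cvgn.
    by apply: sum_box_mono => h; case/andP: (G0 h).
  exists (2 * fine (\esum_(h in [set: freq d]) `|F h|%:E)%E) => _ [K _ <-].
  apply: le_trans (_ : \sum_(h <- box d K) 2 * `|F h| <= _).
    by apply: ler_sum => h _; case/andP: (G0 h).
  rewrite -mulr_sumr ler_pM2l // -lee_fin fineK ?sum_box_le_esum //.
  by rewrite ge0_fin_numE // esum_ge0.
(* Splitting off [F + |F|] and [|F|] leaves two nonnegative families, whose box sums are monotone
   and bounded. *)
have -> : (fun K => \sum_(h <- box d K) F h) =
    (fun K => \sum_(h <- box d K) (F h + `|F h|)) - (fun K => \sum_(h <- box d K) `|F h|).
  by apply/funext => K; rewrite /= fctE -sumrB; apply: eq_bigr => h _; rewrite addrK.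
by apply: is_cvgB; apply: bnd => h; have := ler_norm (F h); have := ler_norm (- F h); rewrite normrN; lra.
Qed.

Lemma le_esum_ltpinfty (R : realType) (T : choiceType) (F G : T -> R) :
    (forall h, F h <= G h) ->
  (\esum_(h in [set: T]) (G h)%:E < +oo)%E -> (\esum_(h in [set: T]) (F h)%:E < +oo)%E.
Proof.
by move=> FG; apply: le_lt_trans; apply: le_esum => h _; rewrite lee_fin.
Qed.

(** * Worst-case error of the median rule *)

(** If the middle entry of the sorted list lay below [a], so would everything before it, leaving at
    most half of the length, rounded down, for the interval; the case above [b] is symmetric. *)
Lemma median_itv (R : realType) (s : seq R) (a b : R) :
  ((size s)./2 < count (fun x => (a <= x <= b)%R) s)%N -> a <= median s <= b.
Proof.
rewrite /median; set t := sort _ s; set i := (size s)./2.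
have -> : count (fun x => a <= x <= b) s = count (fun x => a <= x <= b) t.
  by apply/permP; rewrite perm_sym perm_sort.
have st : size t = size s by rewrite size_sort.
have tmono j k : (j <= k)%N -> (k < size t)%N -> nth 0 t j <= nth 0 t k.
  move=> jk kt; apply: (sorted_leq_nth le_trans le_refl 0 (sort_le_sorted s)) => //.
  by rewrite inE (leq_ltn_trans jk).
move=> ci; have it : (i < size t)%N by rewrite (leq_trans ci) ?count_size.
apply/andP; split; rewrite leNgt; apply/negP => out.
  move: ci; rewrite -(cat_take_drop i.+1 t) count_cat.
  rewrite (_ : count _ (take i.+1 t) = 0)%N; last first.
    apply/eqP; rewrite -leqn0 leqNgt -has_count; apply/hasP => -[x /(nthP 0)[k]].
    rewrite size_takel // => ki; rewrite nth_take // => <- /andP[+ _].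
    by rewrite leNgt => /negP; apply; apply: le_lt_trans out; apply: tmono.
  rewrite add0n => /leq_trans/(_ (count_size _ _)).
  by rewrite size_drop st /i; move: (size s) => n; lia.
move: ci; rewrite -(cat_take_drop i t) count_cat.
rewrite (_ : count _ (drop i t) = 0)%N; last first.
  apply/eqP; rewrite -leqn0 leqNgt -has_count; apply/hasP => -[x /(nthP 0)[k]].
  rewrite size_drop => ki; rewrite nth_drop => <- /andP[_].
  rewrite leNgt => /negP; apply; apply: lt_le_trans out _; apply: tmono.
    exact: leq_addr.
  by rewrite -ltn_subRL.
rewrite addn0 => /leq_trans/(_ (count_size _ _)).
by rewrite size_takel ?ltnn // ltnW.
Qed.

Lemma dual_lattice0 d p z : dual_lattice p z ([ffun => 0] : freq d).
Proof. by rewrite /dual_lattice big1 ?dvdz0 // => j _; rewrite ffunE mul0r. Qed.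

Lemma supp_eq0 d (h : freq d) : (supp h == finset.set0) = (h == [ffun => 0]).
Proof.
apply/eqP/eqP => [/setP h0|->]; last by apply/setP => j; rewrite !inE ffunE eqxx.
by apply/ffunP => j; have := h0 j; rewrite !inE ffunE => /negbFE/eqP.
Qed.

(** * Error of one lattice rule, for the real or the imaginary part *)

Section PartOfLatticeRule.
(* [part] is the real or the imaginary part. *)
Variables (R : realType) (part : R[i] -> R).
Hypothesis partD : {morph part : z1 z2 / z1 + z2}.
Hypothesis part_cRM : forall t z, part (cR t * z) = t * part z.
Hypothesis part_le : forall z, `|part z| <= cnorm z.
Hypothesis part_fourier : forall d (c : freq d -> R[i]) x,
  part (fourier_series c x) = limn (fun K => part (box_sum c x K)).

Lemma part0 : part 0 = 0.
Proof. by apply: (@addrI _ (part 0)); rewrite -partD !addr0. Qed.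

Lemma part_sum I (r : seq I) (P : pred I) (F : I -> R[i]) :
  part (\sum_(i <- r | P i) F i) = \sum_(i <- r | P i) part (F i).
Proof. by apply: big_morph => //; exact: part0. Qed.

Lemma cnormM_expi (z : R[i]) t : cnorm (z * expi t) = cnorm z.
Proof.
rewrite /cnorm; congr Num.sqrt; case: z => a b; rewrite /cre /cim /=.
by have := cos2Dsin2 t; nra.
Qed.

Variables (d : nat) (c : freq d -> R[i]).
Hypothesis c_summable : abs_summable c.

Lemma cvg_part_box_sum x :
  (fun K => part (box_sum c x K)) @ \oo --> part (fourier_series c x).
Proof.
rewrite part_fourier; apply: (_ : cvgn _).
have -> : (fun K => part (box_sum c x K)) =
    (fun K => \sum_(h <- box d K) part (c h * expi (2 * pi * dotx h x))).
  by apply/funext => K; rewrite part_sum -big_box.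
apply: cvg_sum_box; apply: le_esum_ltpinfty c_summable => h.
by apply: le_trans (part_le _) _; rewrite cnormM_expi.
Qed.

(** On a box sum the rule keeps exactly the coefficients in the dual lattice, and the finite average
    over [k] commutes with the limit in [K]. *)
Lemma cvg_part_lattice_rule p z : (0 < p)%N ->
  (fun K => \sum_(h <- box d K | dual_lattice p z h) part (c h)) @ \oo
    --> part (lattice_rule p z (fourier_series c)).
Proof.
move=> p0; rewrite /lattice_rule part_cRM part_sum.
have -> : (fun K => \sum_(h <- box d K | dual_lattice p z h) part (c h)) =
    (fun K => (p%:R)^-1 * \sum_(k < p)
       part (box_sum c (fun j => Defs.frac ((k * z j)%:R / p%:R)) K)).
  apply/funext => K.
  transitivity (part (lattice_rule p z (fun x => box_sum c x K))); last first.
    by rewrite /lattice_rule part_cRM part_sum.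
  rewrite lattice_rule_box_sum // part_sum -big_box big_mkcond /=.
  apply: eq_bigr => g _; case: ifP => _; first by rewrite mulr1.
  by rewrite mulr0 part0.
apply: cvgM; first exact: cvg_cst.
apply: cvg_big => [|k _]; first exact: add_continuous.
exact: cvg_part_box_sum.
Qed.

(** The zero frequency gives the exact integral; the others are bounded by Cauchy-Schwarz with
    weights [w] and [w^-1]. The two-sided form is the one that [median_itv] consumes. *)
Lemma part_lattice_error p z (w : freq d -> R) (A B : R) : (0 < p)%N ->
    (forall h, 0 < w h) -> 0 <= A -> 0 <= B ->
    (forall K, \sum_(h <- box d K) w h ^+ 2 * part (c h) ^+ 2 <= A) ->
    (forall K, \sum_(h <- box d K | (supp h != finset.set0) && dual_lattice p z h)
       (w h)^-1 ^+ 2 <= B) ->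
  part (c [ffun => 0]) - Num.sqrt (A * B) <= part (lattice_rule p z (fourier_series c))
    <= part (c [ffun => 0]) + Num.sqrt (A * B).
Proof.
move=> p0 w0 A0 B0 hA hB; have cv := @cvg_part_lattice_rule p z p0.
set c0 := part (c [ffun => 0]).
have bnd K : `|\sum_(h <- box d K | dual_lattice p z h) part (c h) - c0| <= Num.sqrt (A * B).
  (* The zero frequency belongs to every box and every dual lattice, so it can be split off and
     cancelled against [c0]. *)
  rewrite big_mkcond (bigD1_seq [ffun => 0]) ?box_uniq //=; last first.
    by rewrite mem_box; apply/forallP => j; rewrite ffunE.
  rewrite dual_lattice0 -big_mkcondr addrAC subrr add0r -ler_sqr ?nnegrE ?normr_ge0 ?sqrtr_ge0 //.
  rewrite sqr_sqrtr ?mulr_ge0 // real_normK ?num_real //.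
  rewrite (eq_bigl (fun h => (supp h != finset.set0) && dual_lattice p z h)); last first.
    by move=> h; rewrite supp_eq0.
  rewrite (eq_bigr (fun h => (w h * part (c h)) * (w h)^-1)); last first.
    by move=> h _; rewrite mulrAC mulfV ?mul1r // gt_eqF.
  apply: le_trans (cauchy_schwarz_sum _ _ _ _) _; apply: ler_pM => //.
  - by apply: sumr_ge0 => h _; rewrite sqr_ge0.
  - by apply: sumr_ge0 => h _; rewrite sqr_ge0.
  apply: le_trans (hA K); rewrite big_mkcond /=; apply: ler_sum => h _.
  by case: ifP => _; rewrite ?exprMn // mulr_ge0 ?sqr_ge0.
rewrite -(cvg_lim _ cv) //; apply/andP; split.
  apply: limr_ge; first by apply: cvgP cv.
  by near=> K; have := bnd K; rewrite ler_norml => /andP[+ _]; rewrite lerBrDl lerBlDr addrC.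
apply: limr_le; first by apply: cvgP cv.
by near=> K; have := bnd K; rewrite ler_norml => /andP[_]; rewrite lerBlDr addrC.
Unshelve. all: by end_near. Qed.

End PartOfLatticeRule.

Lemma rweight_gt0 (R : realType) d (alpha : R) (gamma : {set 'I_d} -> R) h :
  (forall u, 0 < gamma u) -> 0 < rweight alpha gamma h.
Proof.
move=> g0; rewrite mulr_gt0 ?invr_gt0 // prodr_gt0 // => j.
by rewrite inE => hj; rewrite powR_gt0 // ltr0z normr_gt0.
Qed.

Lemma cre_le_cnorm (R : realType) (z : R[i]) : `|cre z| <= cnorm z.
Proof. by rewrite -sqrtr_sqr ler_wsqrtr // lerDl sqr_ge0. Qed.

Lemma cim_le_cnorm (R : realType) (z : R[i]) : `|cim z| <= cnorm z.
Proof. by rewrite -sqrtr_sqr ler_wsqrtr // lerDr sqr_ge0. Qed.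

Lemma count_median_rule (R : realType) N (F : 'I_N -> R) (P : pred R) :
  count P [seq F k | k <- enum 'I_N] = #|[pred k | P (F k)]|.
Proof. by rewrite count_map cardE -size_filter enumT. Qed.

(* The estimates for the two parts share the budget [A cre + A cim <= 1] given by
   the norm of [c], so that taking the median of the real and imaginary parts
   separately costs no additional factor. *)
Lemma edet_median_rule_le (R : realType) d N (alpha : R) (gamma : {set 'I_d} -> R)
    (pz : 'I_N -> nat * ('I_d -> nat)) (G : pred 'I_N) (B : R) :
    (forall u, 0 < gamma u) -> 0 <= B -> (N./2 < #|G|)%N ->
    (forall k, G k -> (0 < (pz k).1)%N) ->
    (forall k K, G k ->
       \sum_(h <- box d K | (supp h != finset.set0) && dual_lattice (pz k).1 (pz k).2 h)
          (rweight alpha gamma h)^-1 ^+ 2 <= B) ->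
  (edet alpha gamma (median_rule pz) <= (Num.sqrt B)%:E)%E.
Proof.
move=> g0 B0 NG p0 hB; apply: ge_ereal_sup => _ [c [c_sum c_norm] <-].
rewrite lee_fin; set w := rweight alpha gamma.
have w0 h : 0 < w h by exact: rweight_gt0.
have wx0 h x : 0 <= w h ^+ 2 * x ^+ 2 := mulr_ge0 (sqr_ge0 _) (sqr_ge0 _).
have esum1 : (\esum_(h in [set: freq d]) (w h ^+ 2 * cnorm (c h) ^+ 2)%:E <= 1)%E := c_norm.
have part_cv (part : R[i] -> R) : (forall z, `|part z| <= cnorm z) ->
    cvgn (fun K => \sum_(h <- box d K) w h ^+ 2 * part (c h) ^+ 2).
  move=> part_le; apply: cvg_sum_box.
  apply: (@le_esum_ltpinfty _ _ _ (fun h => w h ^+ 2 * cnorm (c h) ^+ 2) _ (le_lt_trans esum1 (ltry 1))) => h.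
  rewrite ger0_norm // ler_wpM2l ?sqr_ge0 //.
  by rewrite -(real_normK (num_real (part (c h)))) lerXn2r ?nnegrE ?sqrtr_ge0.
have part_nd (prt : R[i] -> R) :
    {homo (fun K => \sum_(h <- box d K) w h ^+ 2 * prt (c h) ^+ 2) : K K' / (K <= K')%N >-> K <= K'}.
  exact: sum_box_mono.
pose A (part : R[i] -> R) := limn (fun K => \sum_(h <- box d K) w h ^+ 2 * part (c h) ^+ 2).
have A0 part : (forall z, `|part z| <= cnorm z) -> 0 <= A part.
  move=> /part_cv cv; apply: le_trans (nondecreasing_cvgn_le (part_nd part) cv 0).
  exact: sumr_ge0.
have A1 : A (@cre R) + A (@cim R) <= 1.
  rewrite /A -limD; [|by apply: part_cv => z; exact: cre_le_cnorm|by apply: part_cv => z; exact: cim_le_cnorm].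
  apply: limr_le; first by apply: is_cvgD; apply: part_cv => z; [exact: cre_le_cnorm|exact: cim_le_cnorm].
  near=> K; rewrite fctE -big_split /= -lee_fin; apply: le_trans esum1.
  apply: le_trans (sum_box_le_esum K _); last by [].
  rewrite lee_fin; apply: ler_sum => h _; rewrite -mulrDr /cnorm sqr_sqrtr //.
  by rewrite addr_ge0 ?sqr_ge0.
have med (part : R[i] -> R) : {morph part : z1 z2 / z1 + z2} ->
    (forall t z, part (cR t * z) = t * part z) -> (forall z, `|part z| <= cnorm z) ->
    (forall d (c : freq d -> R[i]) x,
      part (fourier_series c x) = limn (fun K => part (box_sum c x K))) ->
    (median (map part [seq lattice_rule (pz k).1 (pz k).2 (fourier_series c) | k <- enum 'I_N])
      - part (c [ffun => 0])) ^+ 2 <= A part * B.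
  move=> partD part_cRM part_le part_fourier.
  set s := map part _; have AB0 : 0 <= A part * B by rewrite mulr_ge0 ?A0.
  rewrite -(sqr_sqrtr AB0) -(real_normK (num_real (median s - _))).
  (* The claim becomes membership of the median in an interval around the exact value, which holds
     for each good draw and hence for a majority. *)
  rewrite lerXn2r ?nnegrE ?sqrtr_ge0 // ler_distl.
  apply: median_itv; rewrite /s -map_comp count_median_rule size_map size_enum_ord.
  apply: leq_trans NG _; apply: subset_leq_card; apply/fintype.subsetP => k Gk.
  rewrite inE; apply: (part_lattice_error partD part_cRM part_le part_fourier) => //.
  - exact: p0.
  - exact: A0.
  - by move=> K; apply: nondecreasing_cvgn_le; [exact: part_nd|exact: part_cv].
  - by move=> K; apply: hB.
have Hre := med (@cre R) (@creD R) (@cre_cRM R) (@cre_le_cnorm R) (fun _ _ _ => erefl).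
have Him := med (@cim R) (@cimD R) (@cim_cRM R) (@cim_le_cnorm R) (fun _ _ _ => erefl).
rewrite /cnorm ler_wsqrtr // /integral_d.
set M := median_rule pz _.
have -> : cre (c [ffun => 0] - M) = - (cre M - cre (c [ffun => 0])).
  by rewrite opprB; case: (c _) M => ? ? [].
have -> : cim (c [ffun => 0] - M) = - (cim M - cim (c [ffun => 0])).
  by rewrite opprB; case: (c _) M => ? ? [].
rewrite !sqrrN; apply: le_trans (lerD Hre Him) _.
by rewrite -mulrDl ler_piMl.
Unshelve. all: by end_near. Qed.

(** Writing [z ^ t] as [z * z ^ (t - 1)], each second factor is at most [(x + y) ^ (t - 1)]. *)
Lemma powRD_le (R : realType) (x y t : R) : 0 <= x -> 0 <= y -> 1 <= t ->
  x `^ t + y `^ t <= (x + y) `^ t.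
Proof.
move=> x0 y0 t1.
have E z : 0 <= z -> z `^ t = z * z `^ (t - 1).
  move=> z0; rewrite -{2}(powRr1 z0) -powRD ?subrKC //.
  by apply/implyP => /eqP; lra.
rewrite !E ?addr_ge0 // mulrDl.
have t0 : 0 <= t - 1 by rewrite subr_ge0.
by apply: lerD; rewrite ler_wpM2l // ge0_ler_powR // ?nnegrE ?addr_ge0 // ?lerDl ?lerDr.
Qed.

Lemma sum_powR_le (R : realType) (I : Type) (r : seq I) (P : pred I) (a : I -> R) (t : R) :
    (forall i, 0 <= a i) -> 1 <= t ->
  \sum_(i <- r | P i) a i `^ t <= (\sum_(i <- r | P i) a i) `^ t.
Proof.
move=> a0 t1; elim: r => [|i r IH]; first by rewrite !big_nil powR_ge0.
rewrite !big_cons; case: (P i) => //.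
by apply: le_trans (powRD_le _ _ t1) => //; [rewrite lerD2l|exact: sumr_ge0].
Qed.

(** * Mean of the dual lattice sums *)

(** Cauchy condensation: the block from [2 ^ j] to [2 ^ j.+1] contributes at most [q ^ j], where
    [q = 2 ^ (1 - s) < 1]. *)
Lemma sum_powRN_le (R : realType) (s : R) : 1 < s ->
  exists C : R, forall m, \sum_(1 <= k < m) (k%:R : R) `^ (- s) <= C.
Proof.
move=> s1; pose q : R := 2 * 2 `^ (- s).
have a0 k : 0 <= (k%:R : R) `^ (- s) by exact: powR_ge0.
have q1 : q < 1.
  have -> : q = 2 `^ (1 - s) by rewrite powRD ?powRr1 // ?pnatr_eq0 ?implybT.
  by rewrite /powR pnatr_eq0 /= expR_lt1 nmulr_rlt0 ?subr_lt0 // ln_gt0 ?ltr1n.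
exists (1 - q)^-1 => m.
have H j : (\sum_(1 <= k < 2 ^ j) (k%:R : R) `^ (- s)) * (1 - q) <= 1 - q ^+ j.
  elim: j => [|j IH]; first by rewrite expn0 big_geq // mul0r expr0 subrr.
  have j1 : (2 ^ j <= 2 ^ j.+1)%N by rewrite leq_exp2l.
  rewrite (@big_cat_nat _ _ _ (2 ^ j)) //=; last by rewrite expn_gt0.
  rewrite mulrDl.
  have : \sum_(2 ^ j <= k < 2 ^ j.+1) (k%:R : R) `^ (- s) <= q ^+ j.
    apply: le_trans (_ : \sum_(2 ^ j <= k < 2 ^ j.+1) (2 ^+ j : R) `^ (- s) <= _).
      apply: ler_sum_nat => k /andP[jk _].
      rewrite !powRN lef_pV2 ?posrE ?powR_gt0 ?exprn_gt0 //.
        rewrite ge0_ler_powR ?nnegrE ?exprn_ge0 //; first lra.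
        by rewrite -natrX ler_nat.
      by rewrite ltr0n (leq_trans _ jk) ?expn_gt0.
    rewrite sumr_const_nat expnS mul2n -addnn addnK -[leLHS]mulr_natl natrX.
    by rewrite /q exprMn ler_wpM2l ?exprn_ge0 // -!powR_mulrn ?powR_ge0 // -!powRrM mulrC.
  have q0 : 0 <= q by rewrite mulr_ge0 ?powR_ge0.
  have qj : 0 <= 1 - q by lra.
  move=> /(ler_wpM2r qj); rewrite exprS; move: IH; lra.
have mj : (m <= 2 ^ m)%N by apply/ltnW/ltn_expl.
apply: le_trans (_ : \sum_(1 <= k < 2 ^ m) (k%:R : R) `^ (- s) <= _).
  case: m mj {H} => [|m] mj; first by rewrite [leLHS]big_geq // sumr_ge0.
  by rewrite [leRHS](@big_cat_nat _ _ _ m.+1) //= lerDl sumr_ge0.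
rewrite -[leRHS]mul1r ler_pdivlMr ?subr_gt0 //; apply: le_trans (H m) _.
by rewrite gerBl exprn_ge0 // mulr_ge0 ?powR_ge0.
Qed.

(** Since [zeta] is a [limn], it bounds the partial sums only once their convergence is known, which
    [sum_powRN_le] supplies. *)
Lemma sum_powRN_le_zeta (R : realType) (s : R) m : 1 < s ->
  \sum_(1 <= k < m) (k%:R : R) `^ (- s) <= zeta s.
Proof.
move=> s1; have [C HC] := sum_powRN_le s1.
have nd : {homo (fun m => \sum_(1 <= k < m) (k%:R : R) `^ (- s)) : a b / (a <= b)%N >-> a <= b}.
  move=> [|a] b ab; first by rewrite [leLHS]big_geq // sumr_ge0 // => k _; exact: powR_ge0.
  rewrite [leRHS](@big_cat_nat _ _ _ a.+1) //= lerDl sumr_ge0 // => k _; exact: powR_ge0.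
apply: (nondecreasing_cvgn_le nd); apply: nondecreasing_is_cvgn nd _.
by exists C => _ [k _ <-].
Qed.

Lemma zeta_ge1 (R : realType) (s : R) : 1 < s -> 1 <= zeta s.
Proof.
by move=> s1; apply: le_trans (sum_powRN_le_zeta 2 s1); rewrite big_nat1 powR1.
Qed.

(** Substituting [k = p * l] pulls out the factor [p ^ (- s)], which is at most [p^-1]. *)
Lemma sum_powRN_dvd_le (R : realType) (s : R) p K : 1 < s -> (0 < p)%N ->
  \sum_(1 <= k < K.+1) (p %| k)%N%:R * (k%:R : R) `^ (- s) <= p%:R^-1 * zeta s.
Proof.
move=> s1 p0.
have -> : \sum_(1 <= k < K.+1) (p %| k)%N%:R * (k%:R : R) `^ (- s) =
    p%:R `^ (- s) * \sum_(1 <= k < (K %/ p).+1) (k%:R : R) `^ (- s).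
  elim: K => [|K IH]; first by rewrite div0n !big_geq // mulr0.
  rewrite big_nat_recr //= IH divnS //.
  case: (boolP (p %| K.+1)%N) => [pK|_]; last by rewrite mul0r addr0.
  rewrite add1n [in RHS]big_nat_recr //= mulrDr; congr (_ + _).
  rewrite mul1r -powRM // -natrM; congr (_%:R `^ _).
  by rewrite -[in LHS](divnK pK) divnS // pK mulnC.
apply: ler_pM; rewrite ?powR_ge0 ?sumr_ge0 ?sum_powRN_le_zeta //.
rewrite powRN lef_pV2 ?posrE ?powR_gt0 ?ltr0n //.
by rewrite -{1}[p%:R]powRr1 // ler_powR ?ler1n // ltW.
Qed.

(** A singleton [u] exists because [0 < d]. Strict positivity provides the positive threshold for
    Markov's inequality. *)
Lemma Vd_gt0 (R : realType) d (s : R) (g : {set 'I_d} -> R) : 1 < s -> (0 < d)%N ->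
  (forall u, 0 < g u) -> 0 < Vd s g.
Proof.
move=> s1 d0 g0; have z0 : 0 < zeta s by apply: lt_le_trans (zeta_ge1 s1).
rewrite /Vd (bigD1 [set Ordinal d0]%SET) /=; last first.
  by apply/finset.set0Pn; exists (Ordinal d0); rewrite inE.
rewrite ltr_pwDl ?mulr_gt0 ?exprn_gt0 ?mulr_gt0 // sumr_ge0 // => u _.
by rewrite mulr_ge0 ?exprn_ge0 ?mulr_ge0 // ltW.
Qed.

(** The index [a] encodes the integer [a - K], so every nonzero absolute value occurs twice; this is
    the factor 2 in front of [zeta] in [Vd]. *)
Lemma sum_abs_window (R : realType) (W : nat -> R) K :
  \sum_(a < (2 * K).+1 | a != K :> nat) W `|a%:Z - K%:Z|%N =
  2 * \sum_(1 <= k < K.+1) W k.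
Proof.
rewrite -(big_mkord (fun a => a != K) (fun a => W `|a%:Z - K%:Z|%N)).
rewrite (@big_cat_nat _ _ _ K) //=; last lia.
rewrite [X in _ + X]big_ltn_cond ?eqxx /=; last lia.
have drop a b (P : pred nat) (G : nat -> R) : (forall i, (a <= i < b)%N -> P i) ->
    \sum_(a <= i < b | P i) G i = \sum_(a <= i < b) G i.
  move=> abP; rewrite big_nat_cond [RHS]big_nat_cond; apply: eq_bigl => i.
  by rewrite andbT; apply: andb_idr => /abP.
rewrite mulr_natl mulr2n [X in X + _ = _]drop => [|i]; last lia.
rewrite [X in _ + X = _]drop => [|i]; last lia.
congr (_ + _).
  rewrite big_nat_rev /= add0n [RHS]big_add1 /=.
  by apply: eq_big_nat => k kK; congr W; lia.
rewrite -[X in index_iota X _](add0n K.+1) big_addn [RHS]big_add1 /=.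
have -> : ((2 * K).+1 - K.+1 = K)%N by lia.
by apply: eq_big_nat => k kK; congr W; lia.
Qed.

(** After grouping by support [u], coordinates outside [u] are forced to the index [K], which
    encodes 0, and those in [u] vary independently, so the sum factorizes. *)
Lemma sum_box_supp (R : realType) d K (g : {set 'I_d} -> R) (W : nat -> R) :
  \sum_(h <- box d K | supp h != finset.set0) g (supp h) * \prod_(j in supp h) W `|h j|%N =
  \sum_(u : {set 'I_d} | u != finset.set0) g u * (2 * \sum_(1 <= k < K.+1) W k) ^+ #|u|.
Proof.
rewrite -big_box (partition_big (fun f => supp (box_pt f)) (fun u => u != finset.set0)) //=.
apply: eq_bigr => u u0.
pose Q (j : 'I_d) := [pred a : 'I_(2 * K).+1 | (a != K :> nat) == (j \in u)].
pose F (j : 'I_d) (a : 'I_(2 * K).+1) : R := if j \in u then W `|a%:Z - K%:Z|%N else 1.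
have suppE (f : {ffun 'I_d -> 'I_(2 * K).+1}) j : (j \in supp (box_pt f)) = (f j != K :> nat).
  by rewrite inE ffunE subr_eq0.
transitivity (\sum_(f in family Q) g u * \prod_j F j (f j)).
  apply: eq_big => [f|f /andP[_ /eqP fu]].
    apply/andP/familyP => [[_ /eqP fu] j|fQ].
      by rewrite inE -suppE fu.
    suff -> : supp (box_pt f) = u by rewrite u0 eqxx.
    by apply/setP => j; have := fQ j; rewrite inE suppE => /eqP.
  rewrite fu; congr (_ * _); rewrite [LHS]big_mkcond; apply: eq_bigr => j _.
  by rewrite /F ffunE.
rewrite -mulr_sumr -(bigA_distr_big_dep Q F); congr (_ * _).
rewrite (bigID (mem u)) /= [X in _ * X]big1 ?mulr1 => [|j ju].
  rewrite -[RHS]prodr_const; apply: eq_bigr => j ju.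
  rewrite -sum_abs_window; apply: eq_big => [a|a _]; first by rewrite ju eqb_id.
  by rewrite /F ju.
rewrite (big_pred1 (inord K)) /F ?(negbTE ju) // => a.
rewrite /= eqbF_neg negbK; apply/eqP/eqP => [aK|->].
  by apply/val_inj; rewrite /= inordK; lia.
by rewrite inordK; lia.
Qed.

(** Only nonempty [u] occur, so [c ^ #|u| <= c]. The lemma serves with [c = 1] for the total mass
    and [c = p^-1] for the multiples of [p]. *)
Lemma sum_box_le_Vd (R : realType) d K (s : R) (g : {set 'I_d} -> R) (W : nat -> R) (c : R) :
    1 < s -> (forall u, 0 <= g u) -> (forall k, 0 <= W k) -> 0 <= c <= 1 ->
    \sum_(1 <= k < K.+1) W k <= c * zeta s ->
  \sum_(h <- box d K | supp h != finset.set0) g (supp h) * \prod_(j in supp h) W `|h j|%N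
  <= c * Vd s g.
Proof.
move=> s1 g0 W0 /andP[c0 c1] Wc; rewrite sum_box_supp /Vd [leRHS]mulr_sumr.
have z0 : 0 <= zeta s by apply: le_trans (zeta_ge1 s1).
apply: ler_sum => u u0; rewrite mulrCA ler_wpM2l //.
have u1 : (0 < #|u|)%N by rewrite card_gt0.
apply: le_trans (_ : (c * (2 * zeta s)) ^+ #|u| <= _).
  rewrite lerXn2r ?nnegrE ?mulr_ge0 ?sumr_ge0 //.
  by rewrite mulrCA ler_wpM2l.
rewrite exprMn ler_wpM2r ?exprn_ge0 ?mulr_ge0 //.
by rewrite -(prednK u1) exprS ler_piMr // exprn_ile1.
Qed.

Lemma powR_prod (R : realType) (I : Type) (r : seq I) (P : pred I) (a : I -> R) (t : R) :
    (forall i, 0 <= a i) ->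
  (\prod_(i <- r | P i) a i) `^ t = \prod_(i <- r | P i) (a i `^ t).
Proof.
move=> a0; elim: r => [|i r IH]; first by rewrite !big_nil powR1.
by rewrite !big_cons; case: (P i) => //; rewrite powRM ?IH // prodr_ge0.
Qed.

Lemma rweightV_powR (R : realType) d (alpha lambda : R) (gamma : {set 'I_d} -> R) h :
    (forall u, 0 < gamma u) ->
  (rweight alpha gamma h)^-1 `^ lambda^-1 =
  gamma (supp h) `^ lambda^-1 *
  \prod_(j in supp h) ((`|h j|%N%:R : R) `^ (- (alpha / lambda))).
Proof.
move=> g0; rewrite /rweight invfM invrK powRM; last 2 first.
- exact: ltW.
- by rewrite invr_ge0 prodr_ge0 // => j _; exact: powR_ge0.
congr (_ * _); rewrite -prodfV powR_prod => [|j]; last by rewrite invr_ge0 powR_ge0.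
by apply: eq_bigr => j _; rewrite -powRN -powRrM mulNr.
Qed.

(** * Counting generating vectors for a fixed prime *)

Section Counting.
Variables (n d : nat).

Definition valid_z (p : nat) (z : {ffun 'I_d -> 'I_n.+1}) := [forall j, (0 < z j)%N && (z j < p)%N].

Lemma card_interval_ord p : (0 < p <= n)%N ->
  #|[pred i : 'I_n.+1 | (0 < i)%N && (i < p)%N]| = p.-1.
Proof.
move=> /andP[p0 pn]; rewrite -sum1_card.
rewrite -(big_mkord (fun i => (0 < i)%N && (i < p)%N) (fun=> 1%N)).
rewrite -[RHS](_ : \sum_(1 <= i < p) 1 = _)%N; last by rewrite sum_nat_const_nat muln1 subn1.
rewrite big_ltn_cond //= [RHS]big_nat_cond.
rewrite (@big_cat_nat _ _ _ p) //=; last lia.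
rewrite [X in (_ + X)%N]big_nat_cond [X in (_ + X)%N]big_pred0 ?addn0; last by move=> i; lia.
by rewrite big_nat_cond; apply: eq_bigl => i; lia.
Qed.

Lemma card_valid_z p : (0 < p <= n)%N -> #|[pred z | valid_z p z]| = (p.-1 ^ d)%N.
Proof.
move=> pn; rewrite -[d in RHS]card_ord -(card_interval_ord pn) -card_ffun_on.
by apply: eq_card => z; apply/forallP/ffun_onP.
Qed.

(* Overwriting a coordinate [j] with [p] not dividing [h j] by an arbitrary value is injective on the pairs (value, dual vector). *)
Lemma card_dual_z p (h : freq d) (j : 'I_d) : prime p -> (p <= n)%N ->
    ~~ (p %| `|h j|)%N ->
  (#|[pred z : {ffun 'I_d -> 'I_n.+1} | valid_z p z && dual_lattice p (fun i => nat_of_ord (z i)) h]| * p.-1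
     <= p.-1 ^ d)%N.
Proof.
move=> pp pn hj; have p0 := prime_gt0 pp.
have pn' : (0 < p <= n)%N by rewrite p0.
rewrite -(card_valid_z pn') -(card_interval_ord pn') -cardX.
pose phi (x : {ffun 'I_d -> 'I_n.+1} * 'I_n.+1) : {ffun 'I_d -> 'I_n.+1} :=
  [ffun i => if i == j then x.2 else x.1 i].
rewrite -(@card_in_imset _ _ phi) => [|[z a] [z' a']].
  apply: subset_leq_card; apply/fintype.subsetP => _ /imsetP[[z a] + ->].
  rewrite !inE /= => /andP[/andP[/forallP vz _] va].
  by apply/forallP => i; rewrite ffunE /=; case: ifP.
rewrite !inE /= => /andP[/andP[/forallP vz dz] va] /andP[/andP[/forallP vz' dz'] va'].
move=> /ffunP E; have aa : a = a' by have := E j; rewrite !ffunE eqxx.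
have zz i : i != j -> z i = z' i.
  by move=> /negbTE ij; have := E i; rewrite !ffunE ij.
congr (_, _) => //; apply/ffunP => i; have [->|/zz //] := eqVneq i j.
(* Both vectors are dual and agree off [j], so subtracting the two congruences isolates coordinate
   [j]; its values are below [p], hence equal. *)
have : (p %| h j * (z j)%:Z - h j * (z' j)%:Z)%Z.
  have := rpredB dz dz'; rewrite /dual_lattice (bigD1 j) //= [X in _ - X](bigD1 j) //=.
  rewrite (eq_bigr (fun i => h i * (z' i)%:Z)) => [|k kj]; last by rewrite zz.
  by rewrite opprD addrACA subrr addr0.
rewrite -mulrBr dvdzE abszM Euclid_dvdM // (negbTE hj) /= => pz.
have := vz j; have := vz' j => /andP[_ z1] /andP[_ z2].
apply/val_inj => /=; apply/eqP; move: pz z1 z2.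
move: (nat_of_ord (z j)) (nat_of_ord (z' j)) => u v pz z1 z2.
have [/eqP|/dvdn_leq] := posnP `|u%:Z - v%:Z|%N; first lia.
by move=> /(_ _ pz); lia.
Qed.

End Counting.

Lemma primes_set_gt0 n : (2 <= n)%N -> (0 < #|primes_set n|)%N.
Proof.
move=> n2; have [|p pp /andP[np pn]] := @bertrand n.+1./2; first lia.
have pn1 : (p < n.+1)%N.
  (* Bertrand's interval can reach [n.+1] when [n] is odd; that endpoint is then even and larger
     than 2, so it is not prime. *)
  have [pE|] := eqVneq p n.+1; last lia.
  have : ~~ odd p by lia.
  by move=> /(prime_oddPn pp); lia.
apply/card_gt0P; exists (Ordinal pn1).
by rewrite inE /= pp.
Qed.

(** * The law of a single draw and the Markov bound on bad draws *)

Section SampleLaw.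
Variables (R : realType) (n d : nat).
Hypothesis n2 : (2 <= n)%N.

Lemma pz_weight_ge0 (x : sample n d) : 0 <= pz_weight R x.
Proof. by rewrite /pz_weight; case: ifP => // _; rewrite invr_ge0 mulr_ge0 ?exprn_ge0. Qed.

Lemma primes_setP (p : 'I_n.+1) : p \in primes_set n -> prime p /\ (n <= p.-1.*2)%N.
Proof. by rewrite inE => /andP[pp np]; split=> //; lia. Qed.

Lemma sum_pz_weight (f : sample n d -> R) :
  \sum_x pz_weight R x * f x = #|primes_set n|%:R^-1 *
    \sum_(p in primes_set n) ((p.-1)%:R ^+ d)^-1 * \sum_(z | valid_z p z) f (p, z).
Proof.
transitivity (\sum_p \sum_(z : {ffun 'I_d -> 'I_n.+1}) pz_weight R (p, z) * f (p, z)).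
  by rewrite pair_bigA; apply: eq_bigr => -[].
rewrite mulr_sumr [RHS]big_mkcond; apply: eq_bigr => p _.
case: ifP => pP; last by rewrite big1 // => z _; rewrite /pz_weight /= pP mul0r.
rewrite mulrA mulr_sumr [RHS]big_mkcond; apply: eq_bigr => z _.
by rewrite /pz_weight /= pP /= -/(valid_z p z); case: ifP; rewrite ?mul0r // invfM.
Qed.

Lemma sum_primes_set_le (f : 'I_n.+1 -> R) c : (forall p, p \in primes_set n -> f p <= c) ->
  #|primes_set n|%:R^-1 * \sum_(p in primes_set n) f p <= c.
Proof.
move=> fc; rewrite mulrC ler_pdivrMr ?ltr0n ?primes_set_gt0 //.
by rewrite mulr_natr -sumr_const ler_sum.
Qed.

Lemma sum_pz_weight1 : \sum_(x : sample n d) pz_weight R x = 1.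
Proof.
under eq_bigr do rewrite -[pz_weight R _]mulr1.
rewrite (sum_pz_weight (fun=> 1)) (eq_bigr (fun=> 1)).
  by rewrite sumr_const mulVf // pnatr_eq0 -lt0n primes_set_gt0.
move=> p /primes_setP[pp np]; rewrite sumr_const card_valid_z; last first.
  by rewrite prime_gt0 //= -ltnS.
by rewrite -natrX mulVf // pnatr_eq0 -lt0n expn_gt0; lia.
Qed.

Variables (alpha lambda : R) (gamma : {set 'I_d} -> R).
Hypothesis gamma_gt0 : forall u, 0 < gamma u.
Hypothesis lambda_gt0 : 0 < lambda.
Hypothesis lambda_lt : lambda < alpha.

Let V := Vd (alpha / lambda) (fun u => gamma u `^ lambda^-1).
Let rho (h : freq d) := (rweight alpha gamma h)^-1 `^ lambda^-1.
Let dual (x : sample n d) := dual_lattice x.1 (fun j => nat_of_ord (x.2 j)).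

(** Truncation to a box keeps the sum finite; [good_sample] then asks for a bound uniform in [K]. *)
Definition dual_sum (x : sample n d) K :=
  \sum_(h <- box d K | (supp h != finset.set0) && dual x h) rho h.

Let s1 : 1 < alpha / lambda.
Proof. by rewrite ltr_pdivlMr ?mul1r. Qed.

(** Frequencies divisible by [p] in every coordinate are dual to every [z], so averaging over [z]
    gains nothing; the smallness comes from their weights. *)
Lemma sum_box_dvd_le p K : prime p ->
  \sum_(h <- box d K | supp h != finset.set0) rho h * [forall j, (p %| `|h j|)%N]%:R
  <= p%:R^-1 * V.
Proof.
move=> pp; have p0 := prime_gt0 pp.
pose W (k : nat) : R := (p %| k)%N%:R * k%:R `^ (- (alpha / lambda)).
have W0 k : 0 <= W k by rewrite mulr_ge0 // powR_ge0.
apply: le_trans (@sum_box_le_Vd R d K _ (fun u => gamma u `^ lambda^-1) W p%:R^-1 s1 _ W0 _ _).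
- apply: ler_sum => h _; rewrite /rho rweightV_powR // -mulrA.
  rewrite ler_wpM2l ?powR_ge0 // /W big_split /= mulrC ler_wpM2r //.
    by apply: prodr_ge0 => j _; rewrite powR_ge0.
  case: forallP => [hp|_]; last exact: prodr_ge0.
  by rewrite big1 // => j _; rewrite hp.
- by move=> u; rewrite powR_ge0.
- by rewrite invr_ge0 ler0n invf_le1 ?ltr0n // ler1n.
- exact: sum_powRN_dvd_le.
Qed.

Lemma sum_box_rho_le K : \sum_(h <- box d K | supp h != finset.set0) rho h <= V.
Proof.
pose W (k : nat) : R := k%:R `^ (- (alpha / lambda)).
have W0 k : 0 <= W k by rewrite powR_ge0.
rewrite -[leRHS]mul1r.
apply: le_trans (@sum_box_le_Vd R d K _ (fun u => gamma u `^ lambda^-1) W 1 s1 _ W0 _ _).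
- by apply: ler_sum => h _; rewrite /rho rweightV_powR.
- by move=> u; rewrite powR_ge0.
- by rewrite ler01 lexx.
- by rewrite mul1r; exact: sum_powRN_le_zeta.
Qed.

Lemma V_ge0 : 0 <= V.
Proof.
apply: sumr_ge0 => u _; rewrite mulr_ge0 ?powR_ge0 // exprn_ge0 // mulr_ge0 //.
exact: le_trans (zeta_ge1 s1).
Qed.

Lemma mean_dual_sum_le K :
  \sum_x pz_weight R x * dual_sum x K <= 4 / n%:R * V.
Proof.
rewrite sum_pz_weight; apply: sum_primes_set_le => p /primes_setP[pp np].
have p0 := prime_gt0 pp; have p1 := prime_gt1 pp.
have pn : (p <= n)%N by rewrite -ltnS.
rewrite /dual_sum; under eq_bigr do rewrite big_mkcondr /=.
rewrite exchange_big /= mulr_sumr.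
(* The fraction of [z] dual to [h] is at most 1 if [p] divides all of [h], and at most [1 / (p - 1)]
   otherwise. Each of the two resulting sums is at most [2 * V / n]. *)
apply: le_trans (_ : \sum_(h <- box d K | supp h != finset.set0)
   (rho h * [forall j, (p %| `|h j|)%N]%:R + rho h * (p.-1)%:R^-1) <= _).
  apply: ler_sum => h _; rewrite -big_mkcondr sumr_const -[X in _ * X]mulr_natr.
  rewrite mulrCA -mulrDr ler_wpM2l ?powR_ge0 //.
  rewrite -natrX mulrC ler_pdivrMr ?ltr0n ?expn_gt0; last by lia.
  case: forallP => [_|/forallP]; last first.
    rewrite negb_forall => /existsP[j hj]; rewrite add0r mulrC ler_pdivlMr ?ltr0n; last lia.
    by rewrite -natrM ler_nat; exact: (card_dual_z pp pn hj).
  apply: le_trans (_ : (p.-1 ^ d)%:R <= _).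
    rewrite ler_nat -(@card_valid_z n) ?p0 //; apply: subset_leq_card.
    by apply/fintype.subsetP => z; rewrite !inE => /andP[].
  by rewrite ler_peMl // lerDl invr_ge0.
rewrite big_split /= -mulr_suml.
have n0 : 0 < n%:R :> R by rewrite ltr0n; lia.
have pV : (p.-1)%:R^-1 <= 2 / n%:R :> R.
  rewrite -[leRHS]invrK invf_div lef_pV2 ?posrE ?divr_gt0 ?ltr0n //; try lia.
  by rewrite ler_pdivrMr // -natrM ler_nat muln2.
have pV' : p%:R^-1 <= 2 / n%:R :> R.
  by apply: le_trans pV; rewrite lef_pV2 ?posrE ?ltr0n ?ler_nat; lia.
have -> : 4 / n%:R * V = 2 / n%:R * V + 2 / n%:R * V by field; rewrite gt_eqF.
apply: lerD; first by apply: le_trans (sum_box_dvd_le K pp) _; rewrite ler_wpM2r // V_ge0.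
by rewrite mulrC; apply: ler_pM; rewrite ?invr_ge0 ?sum_box_rho_le ?sumr_ge0 // => h _; exact: powR_ge0.
Qed.

Lemma dual_sum_mono x : {homo dual_sum x : K K' / (K <= K')%N >-> K <= K'}.
Proof.
move=> K K' KK'; rewrite /dual_sum [leLHS]big_mkcond [leRHS]big_mkcond.
by apply: (sum_box_mono _ KK') => h; case: ifP => // _; exact: powR_ge0.
Qed.

Definition good_sample (T : R) (x : sample n d) : Prop :=
  (0 < x.1)%N /\ forall K, dual_sum x K <= T.

Lemma bad_sample_le (T q : R) : 0 < T -> 4 / n%:R * V <= q * T ->
  \sum_(x | ~~ `[< good_sample T x >]) pz_weight R x <= q.
Proof.
move=> T0 VT.
have bigK x : exists K, ~ (forall K, dual_sum x K <= T) -> T < dual_sum x K.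
  have [H|/existsNP[K /negP]] := pselect (forall K, dual_sum x K <= T); first by exists 0%N.
  by rewrite -ltNge => KT; exists K.
(* There are finitely many samples and [dual_sum] is monotone in [K], so one box detects every
   violation and Markov's inequality is applied only once. *)
have [f Hf] := choice bigK; pose K := (\max_x f x)%N.
apply: le_trans (@markov_fin _ _ _ (fun x => dual_sum x K) T q pz_weight_ge0 _ T0 _).
- rewrite big_mkcond [leRHS]big_mkcond; apply: ler_sum => x _.
  case: ifPn => [/asboolPn bad|_]; last by case: ifP => // _; exact: pz_weight_ge0.
  case: ifPn => // /negP TK; rewrite /pz_weight; case: ifP => // /andP[/primes_setP[pp _] _].
  case: bad; split; first exact: prime_gt0.
  apply: contrapT => /Hf Tf; apply: TK; apply: lt_le_trans Tf _.
  by apply: dual_sum_mono; exact: leq_bigmax.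
- by move=> x; apply: sumr_ge0 => h _; exact: powR_ge0.
- by apply: le_trans VT; exact: mean_dual_sum_le.
Qed.

(** The squared inverse weight is [rho h ^ (2 * lambda)], and [2 * lambda >= 1] allows the power to
    be moved outside the sum. *)
Lemma good_sample_weightV2 (T : R) x K : 1 / 2 <= lambda -> 0 < T -> good_sample T x ->
  \sum_(h <- box d K | (supp h != finset.set0) && dual_lattice x.1 (fun j => nat_of_ord (x.2 j)) h)
     (rweight alpha gamma h)^-1 ^+ 2 <= T `^ (2 * lambda).
Proof.
move=> l2 T0 [_ /(_ K) xT].
rewrite (eq_bigr (fun h => rho h `^ (2 * lambda))) => [|h _]; last first.
  rewrite /rho -powRrM mulrCA mulVf ?gt_eqF // mulr1 powR_mulrn //.
  by rewrite invr_ge0 ltW // rweight_gt0.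
apply: le_trans (sum_powR_le _ _ _ _) _; [by move=> h; exact: powR_ge0|lra|].
rewrite ge0_ler_powR ?nnegrE //; first lra.
- by apply: sumr_ge0 => h _; exact: powR_ge0.
- exact: ltW.
Qed.

End SampleLaw.

(* On a finite sample space the infimum over [lambda] can be replaced by a single well-chosen [lambda]. *)
Lemma le_ereal_inf_fin (R : realType) (T : finType) (X : T -> \bar R) (L : set R) (B : R -> R) :
    L !=set0 ->
  exists2 l, L l & forall w, (X w <= (B l)%:E)%E ->
    (X w <= ereal_inf [set (B l)%:E | l in L])%E.
Proof.
move=> [l0 Ll0].
suff [l Ll Hl] : exists2 l, L l & forall w, w \in enum T -> (X w <= (B l)%:E)%E ->
    (X w <= ereal_inf [set (B l)%:E | l in L])%E.
  by exists l => // w; apply: Hl; rewrite mem_enum.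
elim: (enum T) => [|w s [l Ll IH]]; first by exists l0.
have [wi|] := leP (X w) (ereal_inf [set (B l)%:E | l in L]).
  by exists l => // v; rewrite inE => /predU1P[->//|/IH].
move=> /ereal_inf_lt[_ [l' Ll' <-] lw].
have [ll|ll] := leP (B l) (B l').
  exists l => // v; rewrite inE => /predU1P[->|/IH//].
  by move=> /le_lt_trans/(_ (le_lt_trans _ lw)); rewrite lee_fin ll ltxx => /(_ isT).
exists l' => // v; rewrite inE => /predU1P[->|/IH vl].
  by move=> /le_lt_trans/(_ lw); rewrite ltxx.
by move=> /le_trans h; apply: vl; apply: h; rewrite lee_fin ltW.
Qed.

Theorem mainTheorem6 (R : realType) (h : nat -> R)
  (h_ge1 : forall m, 1 <= h m) (h_inf : h @ \oo --> +oo)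
  (alpha : R) (halpha : 1 / 2 < alpha)
  (d : nat) (hd : (0 < d)%N)
  (gamma : {set 'I_d} -> R) (hgamma : forall u, 0 < gamma u <= 1)
  (hgamma0 : gamma finset.set0 = 1)
  (n : nat) (hn : (2 <= n)%N)
  (tau : R) (htau : 1 / 2 < tau < 1) :
  1 - 1 / 2 * (4 * tau * (1 - tau)) `^ ((Nsamples h n)%:R / 2)
  <= @prob R n d (Nsamples h n) (fun w : omega_space n d (Nsamples h n) =>
        (edet alpha gamma (median_rule (to_pz w))
         <= ereal_inf [set (err_bound alpha gamma n tau lambda)%:E
                      | lambda in [set l : R | (1 / 2 <= l < alpha)%R]])%E).
Proof.
have [m ->] : exists m, Nsamples h n = m.*2.+1.
  by rewrite /Nsamples; eexists; rewrite mul2n.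
have g0 u : 0 < gamma u by case/andP: (hgamma u).
have [|l /andP[l2 la] Hl] := @le_ereal_inf_fin R (omega_space n d m.*2.+1)
  (fun w => edet alpha gamma (median_rule (to_pz w)))
  [set l : R | (1 / 2 <= l < alpha)%R] (err_bound alpha gamma n tau).
  by exists (1 / 2); rewrite /= lexx.
have l0 : 0 < l by apply: lt_le_trans l2; lra.
have s1 : 1 < alpha / l by rewrite ltr_pdivlMr ?mul1r.
set V := Vd (alpha / l) (fun u => gamma u `^ l^-1).
have V0 : 0 < V by apply: Vd_gt0 => // u; rewrite powR_gt0.
have n0 : 0 < n%:R :> R by rewrite ltr0n; lia.
have tau1 : 0 < 1 - tau by lra.
pose T := 4 * Num.sqrt 2 / ((1 - tau) * n%:R) * V.
have s2 : 1 <= Num.sqrt 2 :> R by rewrite -[leLHS]sqrtr1 ler_sqrt; lra.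
have T0 : 0 < T.
  by rewrite mulr_gt0 ?divr_gt0 ?mulr_gt0 //; apply: lt_le_trans s2.
pose bad x := ~~ `[< @good_sample R n d alpha l gamma T x >].
have bad_le : \sum_(x | bad x) pz_weight R x <= 1 - tau.
  apply: bad_sample_le => //.
  (* The allowance [(1 - tau) * T] is the bound on the mean times [sqrt 2], which is at least 1. *)
  have -> : (1 - tau) * T = 4 / n%:R * V * Num.sqrt 2.
    by rewrite /T; field; rewrite !gt_eqF.
  by rewrite ler_peMr // mulr_ge0 ?divr_ge0 // ltW.
have := @majority_tail _ _ _ _ m _ (@pz_weight_ge0 R n d) (sum_pz_weight1 R d hn) htau bad_le.
have := sum_prod_ffun_eq1 m.*2.+1 (sum_pz_weight1 R d hn).
rewrite (bigID (fun w : {ffun _} => (m < #|[set k | bad (w k)]%SET|)%N)) /= => S1 tail.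
apply: le_trans (_ : \sum_(w : omega_space n d m.*2.+1 | ~~ (m < #|[set k | bad (w k)]%SET|)%N)
   \prod_k pz_weight R (w k) <= _).
  by rewrite -[X in X - _]S1 lerBlDl lerD2r.
rewrite /prob [leLHS]big_mkcond [leRHS]big_mkcond; apply: ler_sum => w _.
(* Outcomes without a bad majority must lie in the event; all others add a nonnegative weight. *)
case: ifPn => [few|_]; last first.
  by case: ifP => // _; apply: prodr_ge0 => k _; exact: pz_weight_ge0.
rewrite ifT //; apply/asboolP/Hl.
(* The error bound [T ^ l] is put in the form [Num.sqrt B] with [B = T ^ (2 * l)], the bound on the
   dual sums of squared inverse weights. *)
have BE : err_bound alpha gamma n tau l = Num.sqrt (T `^ (2 * l)).
  by rewrite mulrC powRrM powR_mulrn ?powR_ge0 // sqrtr_sqr ger0_norm ?powR_ge0.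
rewrite BE; apply: (@edet_median_rule_le _ _ _ _ _ _ (fun k => ~~ bad (w k))) => //.
- exact: powR_ge0.
- have := cardsC [set k | bad (w k)]%SET; rewrite card_ord.
  have -> : #|~: [set k | bad (w k)]%SET| = #|(fun k => ~~ bad (w k))|.
    by apply: eq_card => k; rewrite !inE.
  by move: few; rewrite -leqNgt; move: #|_| #|_| => a b; clear; lia.
- by move=> k /negPn/asboolP[].
- by move=> k K /negPn/asboolP; exact: good_sample_weightV2.
Qed.
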